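(* Let $L\in(0,\infty]$ and let $\|\cdot\|_{X(0,L)}$ be a rearrangement-invariant function norm on $(0,L)$. Let $\nu_1,\nu_2\colon(0,L)\to(0,L)$ be increasing bijections. Assume that $\nu_2\in\overline{D}^{0}$ and, if $L=\infty$, that $\nu_2\in\overline{D}^{\infty}$. Let $u_1,u_2\colon(0,L)\to(0,\infty)$ be nonincreasing. Let $v_1\colon(0,L)\to(0,\infty)$ be a continuous function. Let $v_2\colon(0,L)\to(0,\infty)$ be defined by $$\frac1{v_2(t)}=\int_0^{\nu_2(t)}\xi(s)\,ds,\quad t\in(0,L),$$ where $\xi\colon(0,L)\to(0,\infty)$ is a measurable function. Assume that the function $w=u_1v_2$ satisfies the averaging condition $$\operatorname*{ess\,sup}_{t\in(0,L)}\frac1{t\,w(t)}\int_0^tw(s)\,ds<\infty,$$ the value of this essential supremum being called the averaging constant of $u_1v_2$. Set $\nu=\nu_2\circ\nu_1$, $$v(t)=\nu_1(t)u_1(\nu_1(t))v_1(t)v_2(\nu_1(t)),\quad t\in(0,L),$$ and $$\eta(t)=\frac1{U_2(t)v(\nu^{-1}(t))},\quad t\in(0,L),$$ where $U_2(t)=\int_0^tu_2(s)\,ds$. Assume that $\eta$ and $\frac\eta\xi$ are equivalent to nonincreasing functions. Furthermore, assume that there are positive constants $C_1$ and $C_2$ such that $$\int_0^t\eta(s)u_2(s)\,ds\le C_1U_2(t)\eta(t)\quad\text{for a.e. } t\in(0,L)$$ and $$\frac1t\int_0^tU_2(\nu(s))v(s)\,ds\ge C_2U_2(\nu(t))v(t)\quad\text{for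 a.e. } t\in(0,L).$$ Then $$\big\|R_{u_1,v_1,\nu_1}\big((R_{u_2,v_2,\nu_2}(f^* ))^*\big)\big\|_{X(0,L)}\approx\|R_{u_2,v,\nu}(f^* )\|_{X(0,L)}$$ for every $f\in\mathfrak M^+(0,L)$, in which the multiplicative constants depend only on $\nu_1$, $\nu_2$, $C_1$, $C_2$, the averaging constant of $u_1v_2$ and the multiplicative constants in the equivalences of $\eta$ and $\frac\eta\xi$ to nonincreasing functions.
   Context: Conventions: $\frac1\infty=0\cdot\infty=0$. $\mathfrak{M}(0,L)$ is the set of (Lebesgue) measurable functions on $(0,L)$ with values in $[-\infty,\infty]$, and $\mathfrak{M}^+(0,L)$ is the subset of those that are nonnegative a.e. For $f\in\mathfrak M(0,L)$, $f^*(t)=\inf\{\lambda\in(0,\infty):|\{s\in(0,L):|f(s)|>\lambda\}|\le t\}$, $t\in(0,\infty)$, is its nonincreasing rearrangement. Functions $f,g$ are equimeasurable, $f\sim g$, if $|\{|f|>\lambda\}|=|\{|g|>\lambda\}|$ for every $\lambda\in(0,\infty)$. $P\approx Q$ means $c_1Q\le P\le c_2Q$ with positive constants $c_1,c_2$; two nonnegative functions on $(0,L)$ are equivalent if this holds pointwise with uniform constants. A rearrangement-invariant function norm on $(0,L)$ is a functional $\|\cdot\|_{X(0,L)}\colon\mathfrak{M}^+(0,L)\to[0,\infty]$ such that, for all $f,g,f_k\in\mathfrak M^+(0,L)$ and $\lambda\in[0,\infty)$: (P1) $\|f\|=0$ iff $f=0$ a.e., $\|\lambda f\|=\lambda\|f\|$,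 $\|f+g\|\le\|f\|+\|g\|$; (P2) $f\le g$ a.e. implies $\|f\|\le\|g\|$; (P3) $f_k\nearrow f$ a.e. implies $\|f_k\|\nearrow\|f\|$; (P4) $\|\chi_E\|<\infty$ for every measurable $E$ of finite measure; (P5) for every measurable $E$ of finite measure there is a finite constant $C_E>0$ with $\int_E f\le C_E\|f\|$ for all $f$; (P6) $\|f\|=\|g\|$ whenever $f\sim g$. $\nu_2\in\overline{D}^{0}$ means $\limsup_{t\to0^+}\frac{\nu_2(\theta t)}{\nu_2(t)}<\infty$ for some $\theta>1$; $\nu_2\in\overline{D}^{\infty}$ means $\limsup_{t\to\infty}\frac{\nu_2(\theta t)}{\nu_2(t)}<\infty$ for some $\theta>1$. $R_{u,v,\nu}g(t)=v(t)\int_0^{\nu(t)}|g(s)|u(s)\,ds$, $t\in(0,L)$, $g\in\mathfrak M(0,L)$. *)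

(* Defs.v *)
From HB Require Import structures.
From mathcomp Require Import all_boot all_order all_algebra.
From mathcomp Require Import all_classical all_reals all_analysis.
From mathcomp Require Import measurable_realfun ess_sup_inf.
Import Order.TTheory GRing.Theory Num.Theory.
Import numFieldNormedType.Exports.

Set Implicit Arguments.
Unset Strict Implicit.
Unset Printing Implicit Defensive.

Local Open Scope classical_set_scope.
Local Open Scope ring_scope.
Local Open Scope ereal_scope.

(* The carrier of [R] with the sigma-algebra of all Lebesgue (not only Borel)
   measurable sets; it is the domain of [completed_lebesgue_measure], and as a
   type it is convertible to [R]. *)
Notation lebesgueType R :=
  (caratheodory_type (measure_extension.mu_ext (wlength (@idfun R)))).

Notation leb := (@completed_lebesgue_measure _).

(* The interval (0, L) with L in (0, +oo]. A function on (0, L) is represented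
   by a function on [R], whose values outside (0, L) are irrelevant to all the
   notions below. *)
Definition ival (R : realType) (L : \bar R) : set R :=
  [set t : R | (0 < t)%R /\ t%:E < L].

Definition lmeasurable_fun (R : realType) (L : \bar R) (f : R -> \bar R)
    : Prop :=
  measurable_fun (ival L : set (lebesgueType R))
                 (f : lebesgueType R -> \bar R).

Definition Mplus (R : realType) (L : \bar R) (f : R -> \bar R) : Prop :=
  lmeasurable_fun L f /\ \forall t \ae leb, ival L t -> 0 <= f t.

Definition superlevel (R : realType) (L : \bar R) (f : R -> \bar R) (l : R)
    : set (lebesgueType R) :=
  [set s : R | ival L s /\ l%:E < `|f s|].

Definition rearrangement (R : realType) (L : \bar R) (f : R -> \bar R) (t : R)
    : \bar R :=
  ereal_inf [set l%:E | l in [set l : R | (0 < l)%R /\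
                                          leb (superlevel L f l) <= t%:E]].

Definition equimeasurable (R : realType) (L : \bar R) (f g : R -> \bar R)
    : Prop :=
  forall l : R, (0 < l)%R -> leb (superlevel L f l) = leb (superlevel L g l).

Record ri_norm (R : realType) (L : \bar R) (X : (R -> \bar R) -> \bar R)
    : Prop := RiNorm {
  ri_ge0 : forall f, Mplus L f -> 0 <= X f ;
  ri_eq0 : forall f, Mplus L f ->
    (X f = 0 <-> \forall t \ae leb, ival L t -> f t = 0) ;
  ri_scale : forall f (l : R), Mplus L f -> (0 <= l)%R ->
    X (fun t => l%:E * f t) = l%:E * X f ;
  ri_triangle : forall f g, Mplus L f -> Mplus L g ->
    X (fun t => f t + g t) <= X f + X g ;
  ri_monotone : forall f g, Mplus L f -> Mplus L g ->
    (\forall t \ae leb, ival L t -> f t <= g t) -> X f <= X g ;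
  ri_fatou : forall (F : nat -> R -> \bar R) (f : R -> \bar R),
    (forall k, Mplus L (F k)) -> Mplus L f ->
    (\forall t \ae leb, ival L t ->
       nondecreasing_seq (fun k => F k t) /\ F k t @[k --> \oo] --> f t) ->
    nondecreasing_seq (fun k => X (F k)) /\ X (F k) @[k --> \oo] --> X f ;
  ri_indic : forall E : set (lebesgueType R),
    measurable E -> E `<=` ival L -> leb E < +oo ->
    X (fun t => (\1_E t)%:E) < +oo ;
  ri_integral : forall E : set (lebesgueType R),
    measurable E -> E `<=` ival L -> leb E < +oo ->
    exists C : R, (0 < C)%R /\
      forall f, Mplus L f -> \int[leb]_(t in E) f t <= C%:E * X f ;
  ri_rearrangement : forall f g, Mplus L f -> Mplus L g ->
    equimeasurable L f g -> X f = X g }.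

Definition increasing_bijection (R : realType) (L : \bar R) (nu : R -> R)
    : Prop :=
  set_bij (ival L) (ival L) nu /\
  forall s t, ival L s -> ival L t -> (s < t)%R -> (nu s < nu t)%R.

Definition positive_on (R : realType) (L : \bar R) (f : R -> R) : Prop :=
  forall t, ival L t -> (0 < f t)%R.

Definition nonincreasing_on (R : realType) (L : \bar R) (f : R -> \bar R)
    : Prop :=
  forall s t, ival L s -> ival L t -> (s <= t)%R -> f t <= f s.

Definition Dsup0 (R : realType) (nu : R -> R) : Prop :=
  exists theta : R, (1 < theta)%R /\
    limf_esup (fun t => (nu (theta * t) / nu t)%:E) (0%R : R)^'+ < +oo.

Definition Dsupoo (R : realType) (nu : R -> R) : Prop :=
  exists theta : R, (1 < theta)%R /\
    limf_esup (fun t => (nu (theta * t) / nu t)%:E) (pinfty_nbhs R) < +oo.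

Definition Rop (R : realType) (u v nu : R -> R) (g : R -> \bar R) (t : R)
    : \bar R :=
  (v t)%:E * \int[leb]_(s in `]0%R, nu t[) (`|g s| * (u s)%:E).

(* The primitive of a nonincreasing positive function may be infinite, hence
   the values in [\bar R]. *)
Definition primitive (R : realType) (u : R -> R) (t : R) : \bar R :=
  \int[leb]_(s in `]0%R, t[) (u s)%:E.

Definition ess_sup_on (R : realType) (L : \bar R) (f : R -> \bar R) : \bar R :=
  ess_sup leb (patch (fun=> -oo) (ival L) f).

Definition averaging_constant (R : realType) (L : \bar R) (w : R -> R)
    : \bar R :=
  ess_sup_on L (fun t => ((t * w t)^-1)%:E * primitive w t).

Definition equiv_with (R : realType) (L : \bar R) (a b : R)
    (f h : R -> \bar R) : Prop :=
  forall t, ival L t -> a%:E * h t <= f t /\ f t <= b%:E * h t.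

Definition equiv_nonincreasing (R : realType) (L : \bar R) (a b : R)
    (f : R -> \bar R) : Prop :=
  exists h : R -> \bar R,
    [/\ forall t, ival L t -> 0 <= h t,
        nonincreasing_on L h & equiv_with L a b f h].

(* Main.v *)
Require Import Defs.
From HB Require Import structures.
From mathcomp Require Import all_boot all_order all_algebra.
From mathcomp Require Import all_classical all_reals all_analysis.
From mathcomp Require Import measurable_realfun ess_sup_inf.
From mathcomp Require Import ring lra.
Import Order.TTheory GRing.Theory Num.Theory.
Import numFieldNormedType.Exports.

Local Open Scope classical_set_scope.
Local Open Scope ring_scope.
Local Open Scope ereal_scope.

(* Write [F y] for the integral of [f^* u2] over [(0, y)], [g t = v2 t * F (nu2 t)]
   and [phi t = v t * F (nu t)], so that [phi = R_{u2,v,nu} f^*]. Both bounds are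
   obtained pointwise.

   Lower bound: with [x = nu1 t], [g >= v2 x * F (nu2 (x / theta))] on
   [(x / theta, x)], so [g^*] is at least that large on
   [(0, (1 - 1 / theta) x)], and doubling of [nu2] gives
   [F (nu2 x) <= K * F (nu2 (x / theta))].

   Upper bound: on [(0, x)], [g^* <= v2 * F (nu2 x) + M] for any bound [M] of [g]
   on [[x, L)], so averaging of [u1 v2] bounds [R_{u1,v1,nu1} g^*] by [phi t] plus a
   multiple of [M]. Since [U2 * eta] is comparable to the primitive of [eta * u2],
   whose average with respect to [xi] is almost nonincreasing, [v2 (nu1 s) / v s] is
   almost nonincreasing in [s], which bounds [M] in terms of the values [phi s],
   [s >= t]. The averaging of [U2 (nu _) * v] forces [phi] to exceed a multiple of
   [phi s] on a subset of [(0, s)] of measure at least [delta s]; hence [phi s] is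
   controlled by [phi^* (t / 2 ^ k)], and dilations are bounded on
   rearrangement-invariant spaces. *)

(** * The completed Lebesgue measure on (0, L) *)

Lemma lmeasurable_borel {R : realType} (A : set R) :
  measurable (A : set (measurableTypeR R)) -> measurable (A : set (lebesgueType R)).
Proof. by move=> mA; apply: sub_caratheodory. Qed.

Lemma lmeasurable_interval {R : realType} (A : set R) :
  is_interval A -> measurable (A : set (lebesgueType R)).
Proof. by move=> iA; apply: lmeasurable_borel; exact: is_interval_measurable. Qed.

Lemma leb_itv {R : realType} (i : interval R) :
  leb ([set` i] : set (lebesgueType R)) =
  (if i.1 < i.2 then (i.2 : \bar R) - i.1 else 0)%E.
Proof.
rewrite -lebesgue_measure_itv. by [].
Qed.

Lemma leb_oo {R : realType} (a b : R) : (a <= b)%R ->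
  leb (`]a, b[ : set (lebesgueType R)) = (b - a)%:E.
Proof.
rewrite leb_itv /= lte_fin; by case: ltgtP => // -> _; rewrite subrr.
Qed.

(** [leb] is given by the Lebesgue outer measure, which is monotone on arbitrary sets. *)
Lemma leb_le {R : realType} (A B : set (lebesgueType R)) :
  A `<=` B -> leb A <= leb B.
Proof.
by move=> AB; exact (@le_mu_ext _ _ _ (@wlength R (@idfun R)) A B AB).
Qed.

(** A null set cannot contain an interval of positive length. *)
Lemma ae_exists {R : realType} (P : R -> Prop) (a b : R) :
  (a < b)%R -> (\forall t \ae @completed_lebesgue_measure R, P t) ->
  exists t, [/\ (a < t)%R, (t < b)%R & P t].
Proof.
move=> ab [N [mN N0 PN]].
apply: contrapT => H.
have : leb (`]a, b[ : set (lebesgueType R)) <= leb N.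
  apply: leb_le => t /=; rewrite in_itv/= => /andP[at' tb].
  by apply: PN => /= Pt; apply: H; exists t.
by rewrite N0 (leb_oo _ _ (ltW ab)) lee_fin subr_le0 leNgt ab.
Qed.

Lemma ival_interval {R : realType} {L : \bar R} : is_interval (ival L).
Proof.
move=> x y [x0 _] [_ yL] z /andP[xz zy]; split; first exact: lt_le_trans xz.
by apply: le_lt_trans yL; rewrite lee_fin.
Qed.

Lemma measurable_ival {R : realType} {L : \bar R} :
  measurable (ival L : set (lebesgueType R)).
Proof. exact/lmeasurable_interval/ival_interval. Qed.

Lemma oo_ival {R : realType} {L : \bar R} (x : R) : x%:E <= L ->
  `]0%R, x[ `<=` ival L.
Proof.
move=> xL y /=; rewrite in_itv/= => /andP[y0 yx]; split => //.
by apply: lt_le_trans xL; rewrite lte_fin.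
Qed.

(** Intervals are measurable, and open upper rays generate the sigma-algebra of the extended reals.
    Besides monotone functions this covers the bump [h1] below, which jumps up once and then
    decreases. *)
Lemma lmeasurable_interval_superlevel {R : realType} {L : \bar R}
    (f : R -> \bar R) :
  (forall r : R, is_interval [set t | ival L t /\ r%:E < f t]) ->
  lmeasurable_fun L f.
Proof.
move=> If mD; apply: (measurability _ (ErealGenOInfty.measurableE R)) => //.
move=> _ [_ [r ->] <-].
rewrite (_ : _ `&` _ = [set t | ival L t /\ r%:E < f t]).
  exact: lmeasurable_interval.
by apply/seteqP; split => t [tL]; rewrite /= in_itv/= andbT.
Qed.

Lemma nonincreasing_lmeasurable {R : realType} {L : \bar R} (f : R -> \bar R) :
  nonincreasing_on L f -> lmeasurable_fun L f.
Proof.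
move=> fL; apply: lmeasurable_interval_superlevel => r x y [xL _] [yL ry] z xyz.
have zL : ival L z by apply: (ival_interval x y).
split => //; apply: (lt_le_trans ry); apply: fL => //.
by case/andP: xyz.
Qed.

Lemma nondecreasing_lmeasurable {R : realType} {L : \bar R} (f : R -> \bar R) :
  (forall s t, ival L s -> ival L t -> (s <= t)%R -> f s <= f t) ->
  lmeasurable_fun L f.
Proof.
move=> fL; apply: lmeasurable_interval_superlevel => r x y [xL rx] [yL _] z xyz.
have zL : ival L z by apply: (ival_interval x y).
split => //; apply: (lt_le_trans rx); apply: fL => //.
by case/andP: xyz.
Qed.

(* No measurability is needed: the integral of a nonnegative function is a
   supremum over the simple functions below it. *)
Lemma ge0_le_integral_subset (d : measure_display) (T : measurableType d)
  {R : realType} (mu : {measure set T -> \bar R}) (D E : set T)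
  (f g : T -> \bar R) :
  D `<=` E -> (forall x, D x -> 0 <= f x) -> (forall x, E x -> 0 <= g x) ->
  (forall x, D x -> f x <= g x) ->
  \int[mu]_(x in D) f x <= \int[mu]_(x in E) g x.
Proof.
move=> DE f0 g0 fg; rewrite !ge0_integralE//.
apply: ereal_sup_le => _ [h hf <-]; exists h => // x.
apply: (le_trans (hf x)); rewrite /patch.
case: ifPn => [xD|_]; last by case: ifPn => // /set_mem /g0.
rewrite mem_set; first exact/fg/set_mem.
exact/DE/set_mem.
Qed.

(** * Rearrangements and dilations *)

Lemma measurable_superlevel {R : realType} {L : \bar R} {f : R -> \bar R} (l : R) :
  lmeasurable_fun L f -> measurable (superlevel L f l).
Proof.
move=> mf.
have mA : measurable_fun (ival L : set (lebesgueType R))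
    (fun x : lebesgueType R => `|f x|).
  by apply: measurableT_comp => //; exact: mf.
have := emeasurable_fun_o_infty measurable_ival mA l%:E.
by [].
Qed.

Lemma subset_superlevel {R : realType} {L : \bar R} (f : R -> \bar R) (l m : R) :
  (l <= m)%R -> superlevel L f m `<=` superlevel L f l.
Proof.
by move=> lm s [sL ms]; split => //; apply: le_lt_trans ms; rewrite lee_fin.
Qed.

Lemma rearrangement_ge {R : realType} {L : \bar R} (f : R -> \bar R) (t : R)
    (a : \bar R) :
  (forall m : R, (0 < m)%R -> m%:E < a -> t%:E < leb (superlevel L f m)) ->
  a <= rearrangement L f t.
Proof.
move=> H; apply: le_ereal_inf_tmp => _ [m [m0 mt] <-].
by rewrite leNgt; apply/negP => ma; move: (H m m0 ma); rewrite ltNge mt.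
Qed.

Lemma rearrangement_le {R : realType} {L : \bar R} (f : R -> \bar R) (t : R)
    (a : \bar R) : 0 <= a ->
  (forall m : R, (0 < m)%R -> a <= m%:E -> leb (superlevel L f m) <= t%:E) ->
  rearrangement L f t <= a.
Proof.
case: a => [a||]; [|by move=> *; rewrite leey|by []].
(* The infimum runs over positive levels only and [a] may be 0, hence the slack [e]. *)
rewrite lee_fin => a0 H; apply/lee_addgt0Pr => e e0.
apply: ereal_inf_lbound; exists (a + e)%R => //; split; first by rewrite ltr_wpDl.
by apply: H; [rewrite ltr_wpDl|rewrite lee_fin lerDl ltW].
Qed.

Lemma rearrangement_ge0 {R : realType} {L : \bar R} (f : R -> \bar R) (t : R) :
  0 <= rearrangement L f t.
Proof. by apply: le_ereal_inf_tmp => _ [m [m0 _] <-]; rewrite lee_fin ltW. Qed.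

Lemma abse_rearrangement {R : realType} {L : \bar R} (f : R -> \bar R) (t : R) :
  `|rearrangement L f t| = rearrangement L f t.
Proof. by rewrite gee0_abs// rearrangement_ge0. Qed.

Lemma rearrangement_nonincreasing {R : realType} {L : \bar R} (f : R -> \bar R)
    (s t : R) :
  (s <= t)%R -> rearrangement L f t <= rearrangement L f s.
Proof.
move=> st; apply: ereal_inf_le_tmp => _ [m [m0 mt] <-]; exists m => //; split=> //.
by apply: (le_trans mt); rewrite lee_fin.
Qed.

(** The implication from right to left is the right continuity of the distribution function: the
    superlevel sets at the levels [l + n.+1%:R^-1] increase to the one at [l], so one of them
    already has measure above [t]. *)
Lemma lt_rearrangement {R : realType} {L : \bar R} (f : R -> \bar R) (l t : R) :
  lmeasurable_fun L f -> (0 < l)%R ->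
  (l%:E < rearrangement L f t) = (t%:E < leb (superlevel L f l)).
Proof.
move=> mf l0; apply/idP/idP.
  apply: contraTT; rewrite -!leNgt => lt.
  by apply: ereal_inf_lbound; exists l.
move=> tl.
pose F n := superlevel L f (l + n.+1%:R^-1)%R.
have UF : \bigcup_n F n = superlevel L f l.
  apply/seteqP; split => [s [n _]|s [sL ls]].
    by apply: subset_superlevel; rewrite lerDl invr_ge0.
  have [m lm ms] : exists2 m, (l < m)%R & m%:E < `|f s|.
    move: ls; case: `|f s| => [r||]//.
      rewrite lte_fin => lr; exists ((l + r) / 2)%R; last rewrite lte_fin; lra.
    by move=> _; exists (l + 1)%R; [lra|rewrite ltry].
  have ml : (0 < m - l)%R by lra.
  exists (Num.truncn (m - l)^-1)%R => //; split => //.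
  apply: le_lt_trans ms; rewrite lee_fin -lerBrDl.
  rewrite invf_ple ?posrE//.
  apply/ltW/truncnS_gt.
have Fcvg : leb (F n) @[n --> \oo] --> leb (superlevel L f l).
  rewrite -UF; apply: nondecreasing_cvg_mu.
  - by move=> n; apply: measurable_superlevel.
  - by rewrite UF; apply: measurable_superlevel.
  - move=> n m nm; apply/subsetPset/subset_superlevel.
    by rewrite lerD2l lef_pV2 ?posrE// ler_nat.
have [n tn] : exists n, t%:E < leb (F n).
  apply: contrapT => /forallNP H; move: tl; apply/negP; rewrite -leNgt.
  rewrite -(cvg_lim _ Fcvg)//; apply: lime_le; first by apply/cvg_ex; eexists; exact: Fcvg.
  by apply: nearW => n; move: (H n) => /negP; rewrite -leNgt.
apply: (@lt_le_trans _ _ (l + n.+1%:R^-1)%:E); first by rewrite lte_fin ltrDl invr_gt0.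
apply: rearrangement_ge => m m0; rewrite lte_fin => mn.
by apply: (lt_le_trans tn); apply: leb_le; apply: subset_superlevel; exact: ltW.
Qed.

Lemma leb_ival {R : realType} (L : \bar R) : 0 <= L ->
  leb (ival L : set (lebesgueType R)) = L.
Proof.
case: L => [l l0||//].
  have -> : ival l%:E = `]0%R, l[%classic.
    apply/seteqP; split => t; rewrite /= in_itv/=.
      by move=> [t0]; rewrite lte_fin => tl; rewrite t0.
    by move=> /andP[t0 tl]; split; rewrite ?lte_fin.
  by rewrite leb_oo ?subr0.
have -> : ival (+oo : \bar R) = `]0%R, +oo[%classic.
  apply/seteqP; split => t; rewrite /= in_itv/= andbT; first by case.
  by move=> t0; split; rewrite ?ltry.
by rewrite leb_itv /= ltry sube0.
Qed.

(** By [lt_rearrangement] the superlevel set of the rearrangement is the initial interval (0, d),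
    where [d] is the measure of the one of [f]; as [d <= L], nothing is cut off by (0, L). *)
Lemma equimeasurable_rearrangement {R : realType} {L : \bar R} (f : R -> \bar R) :
  0 <= L -> lmeasurable_fun L f -> equimeasurable L (rearrangement L f) f.
Proof.
move=> L0 mf l l0; set d := leb (superlevel L f l).
have d0 : 0 <= d by apply: measure_ge0.
have dL : d <= L by rewrite -[leRHS]leb_ival//; apply: leb_le => s [].
rewrite (_ : superlevel _ _ _ = ival d) ?leb_ival//.
apply/seteqP; split => t /=.
  by move=> [[t0 tL]]; rewrite abse_rearrangement lt_rearrangement.
move=> [t0 td]; split; first by split => //; apply: lt_le_trans dL.
by rewrite abse_rearrangement lt_rearrangement.
Qed.

Lemma Mplus_ge0 {R : realType} {L : \bar R} (f : R -> \bar R) :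
  lmeasurable_fun L f -> (forall t, ival L t -> 0 <= f t) -> Mplus L f.
Proof. by move=> mf f0; split=> //; apply: aeW. Qed.

Lemma Mplus_rearrangement {R : realType} {L : \bar R} (f : R -> \bar R) :
  Mplus L (rearrangement L f).
Proof.
apply: Mplus_ge0 => [|t _]; last exact: rearrangement_ge0.
by apply: nonincreasing_lmeasurable => s t _ _; apply: rearrangement_nonincreasing.
Qed.

(* [D] stands for a multiple of the distribution function of some function, so
   that [p] is a dilate of its rearrangement. *)
Section dilation.
Context {R : realType} (L : \bar R) (X : (R -> \bar R) -> \bar R).
Hypothesis riX : ri_norm L X.
Hypothesis L0 : 0 < L.
Variables (p : R -> \bar R) (D : R -> \bar R).
Hypothesis p0 : forall t, 0 <= p t.
Hypothesis pD : forall l t, (0 < l)%R -> (l%:E < p t) = (t%:E < D l).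
Hypothesis D0 : forall l, 0 <= D l.

Hypothesis p_nonincreasing : forall s t, (s <= t)%R -> p t <= p s.

Section truncated.
Variable M : R.
Hypotheses (M0 : (0 < M)%R) (ML : (M + M)%:E <= L).

(* [h0] and [h1] are equimeasurable and have disjoint supports, and their sum is
   equimeasurable with [T], the truncated dilate. *)
Let h0 t : \bar R := if (t < M)%R then p t else 0.
Let h1 t : \bar R := if (M <= t < M + M)%R then p (t - M)%R else 0.
Let T t : \bar R := if (t < M + M)%R then p (t / 2)%R else 0.

Let ival_lt t : (0 < t)%R -> (t < M + M)%R -> ival L t.
Proof. by move=> t0 tM; split => //; apply: lt_le_trans ML; rewrite lte_fin. Qed.

Let Mh0 : Mplus L h0.
Proof.
apply: Mplus_ge0 => [|t _]; last by rewrite /h0; case: ifP.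
apply: nonincreasing_lmeasurable => s t _ _ st; rewrite /h0.
case: ifPn => tM; last by case: ifP.
by rewrite ifT ?p_nonincreasing// (le_lt_trans st).
Qed.

Let Mh1 : Mplus L h1.
Proof.
apply: Mplus_ge0 => [|t _]; last by rewrite /h1; case: ifP.
apply: lmeasurable_interval_superlevel => r x y [xL rx] [yL ry] z xyz.
split; first by apply: (ival_interval x y).
(* For [r < 0] the superlevel set is all of (0, L). Otherwise both endpoints lie in [M, 2M), where
   [h1] is a translate of [p]. *)
have [r0|r0] := ltP r 0%R.
  by apply: (@lt_le_trans _ _ 0); rewrite ?lte_fin// /h1; case: ifP.
move: rx ry; rewrite /h1; case: ifPn => [xM _|_]; last by rewrite ltNge lee_fin r0.
case: ifPn => [yM ry|_]; last by rewrite ltNge lee_fin r0.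
rewrite ifT; last lra.
by apply: (lt_le_trans ry); apply: p_nonincreasing; lra.
Qed.

Let MT : Mplus L T.
Proof.
apply: Mplus_ge0 => [|t _]; last by rewrite /T; case: ifP.
apply: nonincreasing_lmeasurable => s t _ _ st; rewrite /T.
case: ifPn => tM; last by case: ifP.
rewrite ifT; last lra.
by apply: p_nonincreasing; lra.
Qed.

(** The common measure of the superlevel sets of [h0] and [h1]; the one of [T] is twice as large.
    Truncating at [M] makes it finite even where [D l] is not. *)
Let m l := fine (mine M%:E (D l)).

Let mE l : (m l)%:E = mine M%:E (D l).
Proof.
have H : 0 <= mine M%:E (D l) by rewrite le_min D0 lee_fin ltW.
rewrite fineK// ge0_fin_numE//.
by apply: (@le_lt_trans _ _ M%:E); rewrite ?ltry// ge_min lexx.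
Qed.

Let m0 l : (0 <= m l)%R.
Proof. by rewrite -lee_fin mE le_min D0 lee_fin ltW. Qed.

Let mM l : (m l <= M)%R.
Proof. by rewrite -lee_fin mE ge_min lexx. Qed.

Let lt_m l t : (t < m l)%R = (t < M)%R && (t%:E < D l).
Proof. by rewrite -lte_fin mE lt_min lte_fin. Qed.

Let abs_ge0 (f : R -> \bar R) t : (forall t, 0 <= f t) -> `|f t| = f t.
Proof. by move=> f0; rewrite gee0_abs. Qed.

Let h0_ge0 t : 0 <= h0 t. Proof. by rewrite /h0; case: ifP. Qed.
Let h1_ge0 t : 0 <= h1 t. Proof. by rewrite /h1; case: ifP. Qed.
Let T_ge0 t : 0 <= T t. Proof. by rewrite /T; case: ifP. Qed.

Let lt_if (b : bool) (x : \bar R) l : (0 < l)%R ->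
  (l%:E < (if b then x else 0)) = b && (l%:E < x).
Proof. by move=> l0; case: b => //=; apply/negbTE; rewrite -leNgt lee_fin ltW. Qed.

Let superlevel_h0 l : (0 < l)%R -> superlevel L h0 l = `]0%R, m l[%classic.
Proof.
move=> l0; apply/seteqP; split => t; rewrite /superlevel/= in_itv/= abs_ge0//.
  by rewrite /h0 lt_if// pD// lt_m => -[[-> _] ->].
rewrite lt_m -pD// => /andP[t0 /andP[tM lt]]; split; first by apply: ival_lt => //; lra.
by rewrite /h0 tM.
Qed.

Let superlevel_h1 l : (0 < l)%R -> superlevel L h1 l = `[M, (M + m l)%R[%classic.
Proof.
move=> l0; apply/seteqP; split => t; rewrite /superlevel/= in_itv/= abs_ge0//.
  rewrite /h1 lt_if// pD// -andbA => -[_ /and3P[-> tM lt]].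
  by rewrite -ltrBlDl lt_m lt andbT; lra.
rewrite -ltrBlDl lt_m -pD// => /andP[t0 /andP[tM lt]].
split; first by apply: ival_lt => //; lra.
by rewrite /h1 t0/= ifT//; lra.
Qed.

Let superlevel_T l : (0 < l)%R -> superlevel L T l = `]0%R, (m l + m l)%R[%classic.
Proof.
move=> l0; apply/seteqP; split => t; rewrite /superlevel/= in_itv/= abs_ge0//.
  rewrite /T lt_if// pD// => -[[-> _] /andP[tM lt]].
  have : (t / 2 < m l)%R by rewrite lt_m lt andbT; lra.
  by move=> ? /=; lra.
move=> /andP[t0 tm]; have : (t / 2 < m l)%R by lra.
rewrite lt_m -pD// => /andP[tM lt].
split; first by apply: ival_lt => //; lra.
by rewrite /T ifT//; lra.
Qed.

Let superlevel_S l : (0 < l)%R -> superlevel L (fun t => h0 t + h1 t) l =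
  superlevel L h0 l `|` superlevel L h1 l.
Proof.
have h_ge0 x : 0 <= h0 x + h1 x by apply: adde_ge0.
move=> l0; apply/seteqP; split => t; rewrite /superlevel/= (abs_ge0 _ _ h_ge0).
  move=> [tL]; rewrite !abs_ge0//; have [tM|tM] := ltP t M.
    have -> : h1 t = 0 by rewrite /h1 leNgt tM.
    by rewrite adde0; left.
  have -> : h0 t = 0 by rewrite /h0 ltNge tM.
  by rewrite add0e; right.
rewrite !abs_ge0//.
by case=> -[tL lt]; split => //; apply: (lt_le_trans lt); rewrite ?leeDl ?leeDr.
Qed.

Let leb_h1 l : leb (`[M, (M + m l)%R[ : set (lebesgueType R)) = (m l)%:E.
Proof.
rewrite leb_itv/= lte_fin; case: ifPn => [_|].
  by rewrite -EFinB addrC addKr.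
by rewrite -leNgt => H; congr (_%:E); have := m0 l; lra.
Qed.

Let X_h1 : X h1 = X h0.
Proof.
apply: (ri_rearrangement riX) => // l l0.
by rewrite superlevel_h0// superlevel_h1// leb_oo// leb_h1 subr0.
Qed.

(** By equimeasurability [X T] is the norm of [h0 + h1]. The triangle inequality leaves two copies
    of [X h0], and [h0 <= p]. *)
Lemma ri_truncated_dilation_le : X T <= 2%:E * X p.
Proof.
have Mp : Mplus L p.
  apply: Mplus_ge0 => //.
  by apply: nonincreasing_lmeasurable => s t _ _; apply: p_nonincreasing.
have Xh0 : X h0 <= X p.
  apply: (ri_monotone riX) => //; apply: aeW => t _ /=.
  by rewrite /h0; case: ifP.
have -> : X T = X (fun t => h0 t + h1 t).
  apply: (ri_rearrangement riX) => //.
    apply: Mplus_ge0 => [|t _]; last exact: adde_ge0.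
    by apply: emeasurable_funD; [exact: Mh0.1|exact: Mh1.1].
  move=> l l0; rewrite superlevel_S// superlevel_T// superlevel_h0// superlevel_h1//.
  have U : leb ((`]0%R, m l[ `|` `[M, (M + m l)%R[)%classic : set (lebesgueType R))
      = leb (`]0%R, m l[ : set (lebesgueType R)) +
        leb (`[M, (M + m l)%R[ : set (lebesgueType R)).
    apply: measureU.
    - by apply: lmeasurable_interval; exact: interval_is_interval.
    - by apply: lmeasurable_interval; exact: interval_is_interval.
    - rewrite -subset0 => t [] /=; rewrite !in_itv/=.
      by move=> /andP[_ tm] /andP[Mt _]; have := mM l; lra.
  have m00 := m0 l.
  by rewrite U leb_h1 !leb_oo// ?addr_ge0// !subr0.
apply: (le_trans (ri_triangle riX Mh0 Mh1)); rewrite X_h1.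
rewrite [2%:E]EFinD ge0_muleDl ?lee_fin// mul1e.
by apply: leeD.
Qed.

End truncated.

(** For finite [L], truncating with [M = L / 2] removes nothing from (0, L). For infinite [L], the
    truncated dilates increase to the full one and the Fatou property carries the bound to the
    limit. *)
Lemma ri_dilation2_le : X (fun t => p (t / 2)%R) <= 2%:E * X p.
Proof.
have Mp2 : Mplus L (fun t => p (t / 2)%R).
  apply: Mplus_ge0 => //.
  by apply: nonincreasing_lmeasurable => s t _ _ st; apply: p_nonincreasing; lra.
have MT M : Mplus L (fun t => if (t < M + M)%R then p (t / 2)%R else 0).
  apply: Mplus_ge0 => [|t _]; last by case: ifP.
  apply: nonincreasing_lmeasurable => s t _ _ st.
  case: ifPn => tM; last by case: ifP.
  by rewrite ifT ?p_nonincreasing//; lra.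
have [[l Ll]|Loo] : (exists l, L = l%:E) \/ L = +oo.
  by move: L0; case: (L) => [l||]//; [left; exists l|right].
  have l0 : (0 < l)%R by rewrite -lte_fin -Ll.
  have M0 : (0 < l / 2)%R by lra.
  apply: le_trans (ri_truncated_dilation_le _ M0 _); last by rewrite Ll lee_fin; lra.
  apply: (ri_monotone riX) => //; apply: aeW => t [_ /=]; rewrite Ll lte_fin => tl.
  by rewrite ifT//; lra.
pose F n t : \bar R := if (t < n.+1%:R + n.+1%:R)%R then p (t / 2)%R else 0.
have [|_ Fcvg] := ri_fatou riX (F := F) (fun n => MT _) Mp2.
  apply: aeW => t _; split.
    move=> a b ab; rewrite /F.
    have ab' : (a.+1%:R <= b.+1%:R :> R)%R by rewrite ler_nat.
    by case: ifPn => ta; [rewrite ifT//; lra|case: ifP].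
  apply: cvg_near_cst; near=> n; rewrite /F ifT//.
  have : (t <= n%:R)%R by near: n; exact: nbhs_infty_ger.
  rewrite -!natr1; have : (0 <= n%:R :> R)%R by [].
  by move=> ? ?; lra.
rewrite -(cvg_lim _ Fcvg)//; apply: lime_le; first by apply/cvg_ex; eexists; exact: Fcvg.
apply: nearW => n; apply: ri_truncated_dilation_le => //.
by rewrite Loo leey.
Unshelve. all: by end_near.
Qed.

End dilation.

Lemma ri_dilation_le {R : realType} (L : \bar R) (X : (R -> \bar R) -> \bar R)
    (f : R -> \bar R) (k : nat) : ri_norm L X -> 0 < L -> Mplus L f ->
  X (fun t => rearrangement L f (t / 2 ^+ k)%R) <= (2 ^+ k)%:E * X f.
Proof.
move=> riX L0 Mf; elim: k => [|k IH].
  rewrite expr0 mul1e (_ : (fun _ => _) = rearrangement L f); last first.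
    by apply/funext => t; rewrite divr1.
  rewrite (ri_rearrangement riX (Mplus_rearrangement f) Mf)//.
  by apply: equimeasurable_rearrangement; [exact: ltW|exact: Mf.1].
have e0 : (0 < 2 ^+ k :> R)%R by rewrite exprn_gt0.
(* Dilating the rearrangement by [2 ^+ k] multiplies its distribution function by [2 ^+ k]; this
   product is the [D] of the factor-2 dilation bound. *)
have := @ri_dilation2_le R L X riX L0 (fun t => rearrangement L f (t / 2 ^+ k)%R)
  (fun l => (2 ^+ k)%:E * leb (superlevel L f l)).
rewrite (_ : (fun t => _) = (fun t => rearrangement L f (t / 2 ^+ k.+1)%R)); last first.
  by apply/funext => t; rewrite exprS invfM mulrA.
move=> H; apply: (le_trans (H _ _ _ _)).
- by move=> t; apply: rearrangement_ge0.
- move=> l t l0; rewrite lt_rearrangement; [|exact: Mf.1|by []].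
  by rewrite EFinM muleC lte_pdivrMl.
- by move=> l; rewrite mule_ge0// lee_fin ltW.
- move=> s t st; apply: rearrangement_nonincreasing.
  by rewrite ler_pM2r// invr_gt0.
rewrite exprS EFinM -muleA; by rewrite lee_pmul2l.
Qed.

(** * Weighted averages of nonincreasing functions *)

Lemma ge0_integral_oo_split {R : realType} (f : R -> \bar R) (a b : R) :
  (0 < a)%R -> (a <= b)%R ->
  measurable_fun (`]0%R, b[ : set (lebesgueType R)) (f : lebesgueType R -> \bar R) ->
  (forall s, `]0%R, b[%classic s -> 0 <= f s) ->
  \int[leb]_(s in `]0%R, b[) f s =
  \int[leb]_(s in `]0%R, a[) f s + \int[leb]_(s in `[a, b[) f s.
Proof.
move=> a0 ab mf f0.
have E : `]0%R, b[%classic = (`]0%R, a[ `|` `[a, b[)%classic.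
  by rewrite -itv_bndbnd_setU// bnd_simp ?ltW.
rewrite E in mf f0 *; apply: ge0_integral_setU => //.
- by apply: lmeasurable_interval; exact: interval_is_interval.
- by apply: lmeasurable_interval; exact: interval_is_interval.
- apply/disj_setPS => t [] /=; rewrite !in_itv/= => /andP[_ ta] /andP[at' _].
  by move: ta; rewrite ltNge at'.
Qed.

Lemma lmeasurable_fun_sub {R : realType} {L : \bar R} {f : R -> \bar R}
    {A : set R} : A `<=` ival L -> lmeasurable_fun L f ->
  measurable_fun (A : set (lebesgueType R)) (f : lebesgueType R -> \bar R).
Proof. by move=> AL mf; apply: (measurable_funS measurable_ival AL mf). Qed.

Lemma primitive_ge0 {R : realType} {L : \bar R} (u : R -> R) (t : R) :
  positive_on L u -> t%:E <= L -> 0 <= primitive u t.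
Proof.
move=> u0 tL; apply: integral_ge0 => s /(oo_ival _ tL) sL.
by rewrite lee_fin ltW// u0.
Qed.

(** With [P], [K] the weights of (0, a) and [a, b), and [I], [J] the integrals over them, this
    compares the averages over (0, a) and (0, b) once a value [c] separates the integrand on the two
    intervals. The cross-multiplied form avoids dividing by infinite quantities. *)
Lemma weighted_split_le {R : realType} (P I J K c : \bar R) :
  0 <= P -> 0 <= I -> 0 <= J -> 0 <= K -> 0 <= c ->
  P * c <= I -> J <= c * K -> P * (I + J) <= (P + K) * I.
Proof.
move=> P0 I0 J0 K0 c0 PcI JcK; rewrite ge0_muleDr// ge0_muleDl//; apply: leeD2l.
apply: (@le_trans _ _ (P * (c * K))); first exact: lee_wpmul2l.
by rewrite muleA [leRHS]muleC; exact: lee_wpmul2r.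
Qed.

Section weighted_average.
Context {R : realType} (L : \bar R) (k : R -> \bar R) (xi : R -> R).
Hypothesis k0 : forall s, ival L s -> 0 <= k s.
Hypothesis k_nonincreasing : nonincreasing_on L k.
Hypothesis xi0 : positive_on L xi.
Hypothesis mxi : lmeasurable_fun L (EFin \o xi).

Let mk : lmeasurable_fun L (fun s => k s * (xi s)%:E).
Proof.
apply: emeasurable_funM; last exact: mxi.
exact: nonincreasing_lmeasurable.
Qed.

Let sub_oo b : ival L b -> `]0%R, b[ `<=` ival L.
Proof. by move=> bL; apply: oo_ival; apply/ltW/bL.2. Qed.

Let sub_co a b : (0 < a)%R -> ival L b -> `[a, b[ `<=` ival L.
Proof.
move=> a0 bL s; rewrite /= in_itv/= => /andP[as' sb].
by apply: (sub_oo _ bL); rewrite /= in_itv/= sb andbT; exact: lt_le_trans as'.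
Qed.

Lemma weighted_integral_ge (a : R) : ival L a ->
  k a * primitive xi a <= \int[leb]_(s in `]0%R, a[) (k s * (xi s)%:E).
Proof.
move=> aL; rewrite -ge0_integralZl//.
- apply: ge0_le_integral_subset => // s sa; have sL := sub_oo _ aL _ sa.
  + by rewrite mule_ge0 ?k0// lee_fin ltW ?xi0.
  + by rewrite mule_ge0 ?k0// lee_fin ltW ?xi0.
  + apply: lee_wpmul2r; first by rewrite lee_fin ltW ?xi0.
    apply: k_nonincreasing => //.
    by move: sa; rewrite /= in_itv/= => /andP[_ /ltW].
- by apply: lmeasurable_interval; exact: interval_is_interval.
- by apply: lmeasurable_fun_sub mxi; exact: sub_oo.
- by move=> s sa; rewrite lee_fin ltW// xi0//; exact: (sub_oo _ aL).
- exact: k0.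
Qed.

Let weighted_integral_le (a b : R) : ival L a -> ival L b ->
  \int[leb]_(s in `[a, b[) (k s * (xi s)%:E) <=
  k a * \int[leb]_(s in `[a, b[) (xi s)%:E.
Proof.
move=> aL bL; have a0 := aL.1; rewrite -ge0_integralZl//.
- apply: ge0_le_integral_subset => // s sa; have sL := sub_co _ _ a0 bL _ sa.
  + by rewrite mule_ge0 ?k0// lee_fin ltW ?xi0.
  + by rewrite mule_ge0 ?k0// lee_fin ltW ?xi0.
  + apply: lee_wpmul2r; first by rewrite lee_fin ltW ?xi0.
    apply: k_nonincreasing => //.
    by move: sa; rewrite /= in_itv/= => /andP[].
- by apply: lmeasurable_interval; exact: interval_is_interval.
- by apply: lmeasurable_fun_sub mxi; exact: sub_co.
- by move=> s sa; rewrite lee_fin ltW// xi0//; exact: (sub_co _ _ a0 bL).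
- exact: k0.
Qed.

(** The value [k a] separates [k] on (0, a) from [k] on [a, b), so enlarging the interval cannot
    raise the average of [k] with respect to [xi]. *)
Lemma weighted_average_le (a b : R) : ival L a -> ival L b -> (a <= b)%R ->
  primitive xi a * \int[leb]_(s in `]0%R, b[) (k s * (xi s)%:E) <=
  primitive xi b * \int[leb]_(s in `]0%R, a[) (k s * (xi s)%:E).
Proof.
move=> aL bL ab; have a0 := aL.1.
rewrite (ge0_integral_oo_split _ a b)//; last 2 first.
- by apply: lmeasurable_fun_sub mk; exact: sub_oo.
- move=> s /(sub_oo _ bL) sL; by rewrite mule_ge0 ?k0// lee_fin ltW ?xi0.
have -> : primitive xi b = primitive xi a + \int[leb]_(s in `[a, b[) (xi s)%:E.
  apply: ge0_integral_oo_split => //.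
    by apply: lmeasurable_fun_sub mxi; exact: sub_oo.
  by move=> s /(sub_oo _ bL) sL; rewrite lee_fin ltW ?xi0.
set I := \int[leb]_(s in `]0%R, a[) (k s * _).
set J := \int[leb]_(s in `[a, b[) (k s * _).
set K := \int[leb]_(s in `[a, b[) (xi s)%:E.
have I0 : 0 <= I.
  apply: integral_ge0 => s /(sub_oo _ aL) sL.
  by rewrite mule_ge0 ?k0// lee_fin ltW ?xi0.
have J0 : 0 <= J.
  apply: integral_ge0 => s /(sub_co _ _ a0 bL) sL.
  by rewrite mule_ge0 ?k0// lee_fin ltW ?xi0.
have K0 : 0 <= K.
  by apply: integral_ge0 => s /(sub_co _ _ a0 bL) sL; rewrite lee_fin ltW ?xi0.
have P0 : 0 <= primitive xi a by apply: primitive_ge0 xi0 _; apply/ltW/aL.2.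
apply: (weighted_split_le _ _ _ _ (k a)) => //; first exact: k0.
  by rewrite muleC; exact: weighted_integral_ge.
exact: weighted_integral_le.
Qed.

End weighted_average.

(** This is the case of the constant weight 1. *)
Lemma average_le {R : realType} {L : \bar R} (k : R -> \bar R) (a b : R) :
  (forall s, ival L s -> 0 <= k s) -> nonincreasing_on L k ->
  ival L a -> ival L b -> (a <= b)%R ->
  a%:E * \int[leb]_(s in `]0%R, b[) k s <= b%:E * \int[leb]_(s in `]0%R, a[) k s.
Proof.
move=> k0 kni aL bL ab.
have m1 : lmeasurable_fun L (EFin \o (fun=> 1%R)) by apply: nonincreasing_lmeasurable.
have := @weighted_average_le R L k (fun=> 1%R) k0 kni (fun _ _ => ltr01) m1 a b aL bL ab.
have p1 t : ival L t -> primitive (fun=> 1%R) t = t%:E.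
  move=> tL; rewrite /primitive integral_cst//=.
    by rewrite mul1e leb_oo ?subr0// ltW ?tL.1.
  by apply: lmeasurable_interval; exact: interval_is_interval.
rewrite !p1//.
under eq_integral do rewrite mule1.
by under [X in _ <= _ * X -> _]eq_integral do rewrite mule1.
Qed.

(** * The doubling conditions at 0 and at infinity *)

Lemma Dsup0_bound {R : realType} {nu : R -> R} (theta : R) :
  limf_esup (fun t => (nu (theta * t) / nu t)%:E) (0%R : R)^'+ < +oo ->
  exists K e : R, [/\ (0 < K)%R, (0 < e)%R & forall t, (0 < t)%R -> (t < e)%R ->
    (nu (theta * t) / nu t <= K)%R].
Proof.
move=> /ereal_inf_lt[_ [V V0 <-] Voo].
have [e /= e0 eV] := V0.
have [K VK] : exists K : R, ereal_sup [set (nu (theta * x) / nu x)%:E | x in V] <= K%:E.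
  move: Voo; case: (ereal_sup _) => [r||]//; first by exists r.
  by exists 0%R; rewrite leNye.
exists (Num.max K 1)%R, e; split => //; first by rewrite lt_max ltr01 orbT.
move=> t t0 te; rewrite le_max -lee_fin; apply/orP; left.
apply: le_trans VK; apply: ereal_sup_ubound; exists t => //; apply: eV => //=.
by rewrite sub0r normrN gtr0_norm.
Qed.

Lemma Dsupoo_bound {R : realType} {nu : R -> R} (theta : R) :
  limf_esup (fun t => (nu (theta * t) / nu t)%:E) (pinfty_nbhs R) < +oo ->
  exists K M : R, [/\ (0 < K)%R & forall t, (M < t)%R ->
    (nu (theta * t) / nu t <= K)%R].
Proof.
move=> /ereal_inf_lt[_ [V V0 <-] Voo].
have [M [_ MV]] := V0.
have [K VK] : exists K : R, ereal_sup [set (nu (theta * x) / nu x)%:E | x in V] <= K%:E.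
  move: Voo; case: (ereal_sup _) => [r||]//; first by exists r.
  by exists 0%R; rewrite leNye.
exists (Num.max K 1)%R, M; split => //; first by rewrite lt_max ltr01 orbT.
move=> t tM; rewrite le_max -lee_fin; apply/orP; left.
by apply: le_trans VK; apply: ereal_sup_ubound; exists t => //; apply: MV.
Qed.

(** * Pointwise bounds *)

Section increasing_bijection.
Context {R : realType} {L : \bar R} {nu : R -> R}.
Hypothesis nuL : increasing_bijection L nu.

Lemma increasing_bijection_ival t : ival L t -> ival L (nu t).
Proof. by move=> tL; have [[nufun _ _] _] := nuL; exact: nufun. Qed.

Lemma increasing_bijection_gt0 t : ival L t -> (0 < nu t)%R.
Proof. by move=> /increasing_bijection_ival[]. Qed.

Lemma increasing_bijection_le s t : ival L s -> ival L t ->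
  (s <= t)%R -> (nu s <= nu t)%R.
Proof.
move=> sL tL; rewrite le_eqVlt => /predU1P[->//|st].
by apply/ltW; apply nuL.2.
Qed.

End increasing_bijection.

Lemma increasing_bijection_comp {R : realType} {L : \bar R} {nu1 nu2 : R -> R} :
  increasing_bijection L nu1 -> increasing_bijection L nu2 ->
  increasing_bijection L (nu2 \o nu1).
Proof.
move=> H1 H2; split; first exact: set_bij_comp H1.1 H2.1.
move=> s t sL tL st; apply: H2.2; try exact: (increasing_bijection_ival H1).
exact: H1.2.
Qed.

(** The limsup conditions control only small and large [t]. Elsewhere [nu t >= nu e], while
    [nu (theta * t)] is at most [L] if [L] is finite, and at most [nu (theta * M)] on the remaining
    range [t <= M] if it is not. *)
Lemma doubling {R : realType} {L : \bar R} {nu : R -> R} : 0 < L ->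
  increasing_bijection L nu -> Dsup0 nu -> (L = +oo -> Dsupoo nu) ->
  exists theta K : R, [/\ (1 < theta)%R, (0 < K)%R & forall t, ival L t ->
    ival L (theta * t)%R -> (nu (theta * t) <= K * nu t)%R].
Proof.
move=> L0 nuL [theta0 [th0 /Dsup0_bound[K0 [e [K00 e0 He]]]]] Hoo.
have nu_gt0 t : ival L t -> (0 < nu t)%R by exact: increasing_bijection_gt0.
have near0 t : ival L t -> (t < e)%R -> (nu (theta0 * t) <= K0 * nu t)%R.
  by move=> tL te; rewrite -ler_pdivrMr ?nu_gt0// He// tL.1.
have [[l Ll]|Loo] : (exists l, L = l%:E) \/ L = +oo.
  by move: L0; case: (L) => [l||]//; [left; exists l|right].
  exists theta0, (Num.max K0 (l / nu e)%R); split => //; first by rewrite lt_max K00.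
  move=> t tL ttL; have [te|et] := ltP t e.
    by rewrite (le_trans (near0 _ tL te))// ler_pM2r ?nu_gt0// le_max lexx.
  have eL : ival L e by split => //; apply: le_lt_trans tL.2; rewrite lee_fin.
  have nul : (nu (theta0 * t) <= l)%R.
    by have [_] := increasing_bijection_ival nuL _ ttL; rewrite Ll lte_fin => /ltW.
  have l0 : (0 <= l / nu e)%R by rewrite divr_ge0 ?ltW ?nu_gt0// -lte_fin -Ll.
  apply: (@le_trans _ _ (l / nu e * nu t))%R.
    rewrite (le_trans nul)// -[X in (X <= _)%R](@divfK _ (nu e)) ?gt_eqF ?nu_gt0//.
    by rewrite ler_wpM2l// (increasing_bijection_le nuL).
  by rewrite ler_pM2r ?nu_gt0// le_max lexx orbT.
have [theta1 [th1 /Dsupoo_bound[K1 [M [K10 HM]]]]] := Hoo Loo.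
have posL t : (0 < t)%R -> ival L t by move=> t0; split; rewrite ?Loo ?ltry.
(* The two conditions may come with different dilation factors; as [nu] is increasing, both bounds
   persist for the smaller one. *)
pose theta := Num.min theta0 theta1.
have thge1 : (1 < theta)%R by rewrite lt_min th0.
have nule s t : (0 < s)%R -> (s <= t)%R -> (nu s <= nu t)%R.
  move=> s0 st; apply: (increasing_bijection_le nuL) => //; apply: posL => //.
  exact: lt_le_trans st.
exists theta, (Num.max K0 (Num.max K1 (nu (theta * M) / nu e)%R)); split => //.
  by rewrite lt_max K00.
move=> t tL ttL; have t0 := tL.1; have nut0 := nu_gt0 _ tL.
have tht : (0 < theta * t)%R by rewrite mulr_gt0//; lra.
have [te|et] := ltP t e.
  apply: (@le_trans _ _ (K0 * nu t)%R); last by rewrite ler_pM2r// le_max lexx.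
  apply: le_trans (near0 _ tL te); apply: nule => //.
  by rewrite ler_pM2r// ge_min lexx.
have [Mt|tM] := ltP M t.
  apply: (@le_trans _ _ (K1 * nu t)%R); last first.
    by rewrite ler_pM2r// !le_max lexx/= orbT.
  rewrite -ler_pdivrMr//; apply: le_trans (HM t Mt).
  rewrite ler_pM2r ?invr_gt0//; apply: nule => //.
  by rewrite ler_pM2r// ge_min lexx orbT.
apply: (@le_trans _ _ (nu (theta * M) / nu e * nu t))%R; last first.
  by rewrite ler_pM2r// !le_max lexx/= !orbT.
have nue : (0 < nu e)%R by apply: nu_gt0; exact: posL.
have numM : (nu (theta * t) <= nu (theta * M))%R.
  by apply: nule => //; rewrite ler_pM2l//; lra.
apply: (le_trans numM); rewrite -mulrA ler_peMr//.
  by apply: ltW; apply: lt_le_trans numM; apply: nu_gt0; exact: posL.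
by rewrite mulrC ler_pdivlMr// mul1r; apply: nule.
Qed.

(* An a.e. inequality between almost monotone quantities is transferred to every
   [x], up to a constant, by evaluating it at a nearby point to the right of [x]. *)
Lemma ae_exists_right {R : realType} {L : \bar R} (P : R -> Prop) (x c : R) :
  (1 < c)%R -> ival L x -> (\forall t \ae @completed_lebesgue_measure R, ival L t -> P t) ->
  exists y, [/\ (x < y)%R, (y < c * x)%R, ival L y & P y].
Proof.
move=> c1 xL HP; have x0 := xL.1.
have xc : (x < c * x)%R by rewrite ltr_pMl.
(* The point is sought below [z], the minimum of [c * x] and [L], since [c * x] may lie beyond
   [L]. *)
have [z [xz zc zL]] : exists z, [/\ (x < z)%R, (z <= c * x)%R & z%:E <= L].
  have [cL|Lc] := leP (c * x)%:E L; first by exists (c * x)%R.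
  have Lfin : L \is a fin_num.
    rewrite ge0_fin_numE; last by apply: ltW; apply: lt_trans xL.2; rewrite lte_fin.
    by apply: (lt_trans Lc); rewrite ltry.
  exists (fine L); rewrite -lte_fin -lee_fin fineK//.
  by split; [exact: xL.2|exact: ltW|].
have [y [xy yz Py]] := ae_exists _ _ _ xz HP.
have yL : ival L y.
  by split; [exact: lt_trans xy|apply: lt_le_trans zL; rewrite lte_fin].
by exists y; split => //; [exact: lt_le_trans zc|exact: Py].
Qed.

(** The essential supremum gives the bound at some [y] in (x, 2x). There the primitive has only
    grown, whereas [y * w y <= 2 * x * w x] by monotonicity; this is the factor 2. The maximum with
    1 yields a constant that is visibly positive. *)
Lemma averaging_bound {R : realType} {L : \bar R} (w : R -> R) (A x : R) :
  positive_on L w -> nonincreasing_on L (EFin \o w) ->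
  averaging_constant L w = A%:E -> ival L x ->
  primitive w x <= (2 * Num.max A 1 * (x * w x))%:E.
Proof.
move=> w0 wni wA xL; have x0 := xL.1.
have Hae : \forall t \ae @completed_lebesgue_measure R, ival L t ->
    ((t * w t)^-1)%:E * primitive w t <= A%:E.
  have := @ess_sup_ge _ _ _ (@completed_lebesgue_measure R)
    (patch (fun=> -oo) (ival L) (fun t => ((t * w t)^-1)%:E * primitive w t)).
  rewrite -/(ess_sup_on L _) -/(averaging_constant L w) wA.
  by apply: filterS => t /= + tL; rewrite /patch mem_set.
have [y [xy yx yL]] := ae_exists_right _ _ 2%R ltac:(lra) xL Hae.
have y0 := yL.1; have wy0 := w0 _ yL; have wx0 := w0 _ xL.
have yw0 : (0 < y * w y)%R by rewrite mulr_gt0.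
rewrite lee_pdivrMl// -EFinM => H.
apply: (@le_trans _ _ (primitive w y)).
  apply: ge0_le_integral_subset => //.
  - by move=> s /=; rewrite !in_itv/= => /andP[-> /lt_trans->].
  - by move=> s /(oo_ival _ (ltW xL.2)) sL; rewrite lee_fin ltW// w0.
  - by move=> s /(oo_ival _ (ltW yL.2)) sL; rewrite lee_fin ltW// w0.
apply: (le_trans H); rewrite lee_fin.
have wyx : (w y <= w x)%R by rewrite -lee_fin; apply: wni => //; exact: ltW.
have A1 : (0 < Num.max A 1)%R by rewrite lt_max ltr01 orbT.
apply: (@le_trans _ _ (y * w y * Num.max A 1))%R.
  by rewrite ler_pM2l// le_max lexx.
rewrite mulrC [leRHS](_ : _ = Num.max A 1 * (2 * x * w x))%R; last by ring.
by rewrite ler_pM2l// ler_pM// ltW.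
Qed.

(** * Integral inequalities for nonnegative functions *)

Lemma ge0_integral_lincomb (d : measure_display) (T : measurableType d)
  (R : realType) (mu : {measure set T -> \bar R}) (D : set T) (a b : \bar R)
  (f g : T -> \bar R) :
  measurable D -> 0 <= a -> 0 <= b ->
  (forall x, D x -> 0 <= f x) -> measurable_fun D f ->
  (forall x, D x -> 0 <= g x) -> measurable_fun D g ->
  \int[mu]_(x in D) (a * f x + b * g x) =
  a * \int[mu]_(x in D) f x + b * \int[mu]_(x in D) g x.
Proof.
move=> mD a0 b0 f0 mf g0 mg; rewrite ge0_integralD//.
- by rewrite !ge0_integralZl.
- by move=> x Dx; rewrite mule_ge0// f0.
- by apply: emeasurable_funM => //; exact: measurable_cst.
- by move=> x Dx; rewrite mule_ge0// g0.
- by apply: emeasurable_funM => //; exact: measurable_cst.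
Qed.

Lemma ge0_scale_integral_le (d : measure_display) (T : measurableType d)
  (R : realType) (mu : {measure set T -> \bar R}) (D E : set T) (c : \bar R)
  (f g : T -> \bar R) :
  measurable D -> D `<=` E -> 0 <= c ->
  (forall x, D x -> 0 <= f x) -> measurable_fun D f ->
  (forall x, E x -> 0 <= g x) -> (forall x, D x -> c * f x <= g x) ->
  c * \int[mu]_(x in D) f x <= \int[mu]_(x in E) g x.
Proof.
move=> mD DE c0 f0 mf g0 fg; rewrite -ge0_integralZl//.
by apply: ge0_le_integral_subset => // x Dx; rewrite mule_ge0// f0.
Qed.

Lemma ge0_le_scale_integral (d : measure_display) (T : measurableType d)
  (R : realType) (mu : {measure set T -> \bar R}) (D : set T) (c : \bar R)
  (f g : T -> \bar R) :
  measurable D -> 0 <= c -> (forall x, D x -> 0 <= f x) ->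
  (forall x, D x -> 0 <= g x) -> measurable_fun D g ->
  (forall x, D x -> f x <= c * g x) ->
  \int[mu]_(x in D) f x <= c * \int[mu]_(x in D) g x.
Proof.
move=> mD c0 f0 g0 mg fg; rewrite -ge0_integralZl//.
by apply: ge0_le_integral_subset => // x Dx; rewrite mule_ge0// g0.
Qed.

Lemma integral_cst_indic (d : measure_display) (T : measurableType d)
  (R : realType) (mu : {measure set T -> \bar R}) (D E : set T) (a b : R) :
  measurable D -> measurable E -> E `<=` D -> (0 <= a)%R -> (0 <= b)%R ->
  \int[mu]_(x in D) (a%:E + b%:E * (\1_E x)%:E) = a%:E * mu D + b%:E * mu E.
Proof.
move=> mD mE ED a0 b0.
have mI : measurable_fun D (fun x => (\1_E x : R)%:E).
  by apply/measurable_EFinP; exact: measurable_indic.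
rewrite ge0_integralD//.
- by rewrite integral_cst// ge0_integralZl// integral_indic// setIidl.
- by move=> x _; apply: mule_ge0; rewrite lee_fin.
- by apply: emeasurable_funM => //; exact: measurable_cst.
Qed.

Lemma oo_ival_in {R : realType} {L : \bar R} {y : R} : ival L y -> `]0%R, y[ `<=` ival L.
Proof. by move=> yL; apply: oo_ival; apply/ltW/yL.2. Qed.

Lemma primitive_gt0 {R : realType} {L : \bar R} {u : R -> R} {t : R} :
  positive_on L u -> nonincreasing_on L (EFin \o u) -> ival L t ->
  0 < primitive u t.
Proof.
move=> u0 uni tL; have t0 := tL.1.
apply: (@lt_le_trans _ _ (t * u t)%:E); first by rewrite lte_fin mulr_gt0 ?u0.
have -> : (t * u t)%:E = \int[leb]_(s in `]0%R, t[) (u t)%:E.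
  rewrite integral_cst/=; last by apply: lmeasurable_interval; exact: interval_is_interval.
  by rewrite leb_oo ?subr0 ?(ltW t0)// mulrC.
apply: ge0_le_integral_subset => //.
- by move=> s _; rewrite lee_fin ltW// u0.
- by move=> s /(oo_ival_in tL) sL; rewrite lee_fin ltW// u0.
- move=> s /[dup] /(oo_ival_in tL) sL; rewrite /= in_itv/= => /andP[_ st].
  by apply: uni => //; exact: ltW.
Qed.

(** * Bounds for the iterated operator at a single point *)

Section hardy.
Context {R : realType} {L : \bar R} {nu1 nu2 u1 u2 v1 v2 xi : R -> R}.
Hypotheses (nu1L : increasing_bijection L nu1) (nu2L : increasing_bijection L nu2).
Hypotheses (u1_gt0 : positive_on L u1) (u1_ni : nonincreasing_on L (EFin \o u1)).
Hypotheses (u2_gt0 : positive_on L u2) (u2_ni : nonincreasing_on L (EFin \o u2)).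
Hypothesis v1_gt0 : positive_on L v1.
Hypotheses (xi_gt0 : positive_on L xi) (mxi : lmeasurable_fun L (EFin \o xi)).
Hypothesis v2_gt0 : positive_on L v2.
Hypothesis v2E : forall t, ival L t -> ((v2 t)^-1)%:E = primitive xi (nu2 t).
Let nu := nu2 \o nu1.
Let v t := (nu1 t * u1 (nu1 t) * v1 t * v2 (nu1 t))%R.

Variable h : R -> \bar R.
Hypothesis h_ge0 : forall t, 0 <= h t.
Hypothesis h_ni : nonincreasing_on L h.

Let F y := \int[leb]_(s in `]0%R, y[) (`|h s| * (u2 s)%:E).
Let g := Rop u2 v2 nu2 h.

Let k_ge0 s : ival L s -> 0 <= `|h s| * (u2 s)%:E.
Proof. by move=> sL; rewrite mule_ge0// lee_fin ltW// u2_gt0. Qed.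

Let k_ni : nonincreasing_on L (fun s => `|h s| * (u2 s)%:E).
Proof.
move=> s t sL tL st; rewrite !gee0_abs//.
by apply: lee_pmul => //; [rewrite lee_fin ltW// u2_gt0|exact: h_ni|exact: u2_ni].
Qed.

Lemma hardy_ge0 y : ival L y -> 0 <= F y.
Proof. by move=> yL; apply: integral_ge0 => s /(oo_ival_in yL); exact: k_ge0. Qed.

Lemma hardy_le a b : ival L a -> ival L b -> (a <= b)%R -> F a <= F b.
Proof.
move=> aL bL ab; apply: ge0_le_integral_subset => //.
- by move=> s /=; rewrite !in_itv/= => /andP[-> /lt_le_trans->].
- by move=> s /(oo_ival_in aL); exact: k_ge0.
- by move=> s /(oo_ival_in bL); exact: k_ge0.
Qed.

Lemma hardy_average_le a b : ival L a -> ival L b -> (a <= b)%R ->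
  a%:E * F b <= b%:E * F a.
Proof. exact: average_le. Qed.

(** [1 / v2] is the primitive of a positive function composed with an increasing one. *)
Lemma v2_nonincreasing s t : ival L s -> ival L t -> (s <= t)%R -> (v2 t <= v2 s)%R.
Proof.
move=> sL tL st; rewrite -lef_pV2 ?posrE ?v2_gt0// -lee_fin !v2E//.
have nusL := increasing_bijection_ival nu2L _ sL.
have nutL := increasing_bijection_ival nu2L _ tL.
have nust := increasing_bijection_le nu2L _ _ sL tL st.
apply: ge0_le_integral_subset => //.
- by move=> x /=; rewrite !in_itv/= => /andP[-> /lt_le_trans->].
- by move=> x /(oo_ival_in nusL) xL; rewrite lee_fin ltW// xi_gt0.
- by move=> x /(oo_ival_in nutL) xL; rewrite lee_fin ltW// xi_gt0.
Qed.

Let g_ge0 s : ival L s -> 0 <= g s.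
Proof.
move=> sL; apply: mule_ge0; first by rewrite lee_fin ltW// v2_gt0.
by apply: hardy_ge0; exact: increasing_bijection_ival nu2L _ sL.
Qed.

Lemma iterated_ge (theta K t : R) : (1 < theta)%R -> (0 < K)%R ->
  (forall t, ival L t -> ival L (theta * t)%R -> (nu2 (theta * t) <= K * nu2 t)%R) ->
  ival L t ->
  ((1 - theta^-1) / K)%:E * Rop u2 v nu h t <=
  Rop u1 v1 nu1 (rearrangement L g) t.
Proof.
move=> th1 K0 dbl tL; set x := nu1 t; have xL : ival L x := increasing_bijection_ival nu1L _ tL.
have x0 := xL.1.
have th0 : (0 < theta)%R by lra.
pose y := (x / theta)%R.
have y0 : (0 < y)%R by rewrite divr_gt0.
have yx : (y < x)%R by rewrite ltr_pdivrMr// ltr_pMr.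
have yL : ival L y by split => //; apply: lt_trans xL.2; rewrite lte_fin.
have xE : (theta * y = x)%R by rewrite mulrC divfK ?gt_eqF.
have nuyL := increasing_bijection_ival nu2L _ yL.
have nuxL := increasing_bijection_ival nu2L _ xL.
(* [F z / z] is nonincreasing, so the ratio of the two values of [F] is at most that of [nu2 x] and
   [nu2 y], which doubling bounds by [K]. *)
have FK : F (nu2 x) <= K%:E * F (nu2 y).
  have nuyx := increasing_bijection_le nu2L _ _ yL xL (ltW yx).
  have nuy0 : 0 < (nu2 y)%:E by rewrite lte_fin; exact: nuyL.1.
  rewrite -(@lee_pmul2l _ (nu2 y)%:E)//.
  apply: (le_trans (hardy_average_le _ _ nuyL nuxL nuyx)).
  rewrite muleA -EFinM [(nu2 y * K)%R]mulrC.
  apply: lee_wpmul2r; first exact: hardy_ge0.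
  by rewrite lee_fin -xE; apply: dbl => //; rewrite xE.
pose a := (v2 x)%:E * F (nu2 y).
have a_ge0 : 0 <= a by rewrite mule_ge0 ?hardy_ge0// lee_fin ltW// v2_gt0.
have ga s : (y < s)%R -> (s < x)%R -> a <= g s.
  move=> ys sx; have sL : ival L s.
    by apply: (ival_interval y x) => //; rewrite !ltW.
  have nusL := increasing_bijection_ival nu2L _ sL.
  apply: lee_pmul; rewrite ?lee_fin; first by rewrite ltW// v2_gt0.
  - exact: hardy_ge0.
  - by apply: v2_nonincreasing => //; exact: ltW.
  - by apply: hardy_le => //; apply: (increasing_bijection_le nu2L) => //; exact: ltW.
(* The superlevel sets of [g] below level [a] contain (y, x), of length [x - y]. *)
have gsa s : (s < x - y)%R -> a <= rearrangement L g s.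
  move=> sxy; apply: rearrangement_ge => m m0 ma.
  apply: (@lt_le_trans _ _ (x - y)%:E); first by rewrite lte_fin.
  rewrite -(leb_oo _ _ (ltW yx)); apply: leb_le => r /=; rewrite in_itv/= => /andP[yr rx].
  split; first by apply: (ival_interval y x) => //; rewrite !ltW.
  by rewrite gee0_abs; [exact: lt_le_trans (ga r yr rx)|apply: le_trans (ga r yr rx)].
(* Only (0, x - y) is kept from the outer integral; there [u1 >= u1 x], and
   [x - y = (1 - theta^-1) * x] produces the constant. *)
apply: (@le_trans _ _ ((v1 t)%:E * (a * (u1 x * (x - y))%:E))); last first.
  apply: lee_wpmul2l; first by rewrite lee_fin ltW// v1_gt0.
  have -> : a * (u1 x * (x - y))%:E = \int[leb]_(s in `]0%R, (x - y)%R[) (a * (u1 x)%:E).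
    rewrite integral_cst; last by apply: lmeasurable_interval; exact: interval_is_interval.
    by rewrite /= leb_oo ?subr0 ?EFinM ?muleA//; lra.
  have u1x0 : (0 < u1 x)%R by apply: u1_gt0.
  apply: ge0_le_integral_subset.
  - move=> s /=; rewrite !in_itv/= => /andP[-> sxy]/=; apply: (lt_le_trans sxy).
    by rewrite gerBl (ltW y0).
  - by move=> s _; rewrite mule_ge0// lee_fin ltW.
  - move=> s /(oo_ival_in xL) sL.
    by rewrite mule_ge0// lee_fin ltW// u1_gt0.
  - move=> s; rewrite /= in_itv/= => /andP[s0 sxy].
    apply: lee_pmul => //; first by rewrite lee_fin ltW.
      by rewrite abse_rearrangement; exact: gsa.
    have sx : (s < x)%R by apply: (lt_le_trans sxy); rewrite gerBl ltW.
    apply: u1_ni => //; last exact: ltW.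
    by apply: (oo_ival_in xL); rewrite /= in_itv/= s0.
rewrite /Rop -/(F _) -/x /a muleA -EFinM.
have -> : (v1 t)%:E * ((v2 x)%:E * F (nu2 y) * (u1 x * (x - y))%:E) =
    ((1 - theta^-1) / K * v t)%:E * (K%:E * F (nu2 y)).
  rewrite !muleA [LHS]muleAC -!EFinM; congr (_%:E * _).
  by rewrite /v -/x /y; field; rewrite !gt_eqF.
apply: lee_wpmul2l; last exact: FK.
have ltV : (0 < 1 - theta^-1)%R by rewrite subr_gt0 invf_lt1.
have vt0 : (0 < v t)%R by rewrite !mulr_gt0 ?u1_gt0 ?v1_gt0 ?v2_gt0.
by rewrite lee_fin ltW// mulr_gt0 ?divr_gt0.
Qed.

Let w s := (u1 s * v2 s)%R.

Let xL t : ival L t -> ival L (nu1 t).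
Proof. by move=> tL; exact: increasing_bijection_ival nu1L _ tL. Qed.

Let nuL t : ival L t -> ival L (nu t).
Proof. by move=> tL; exact: increasing_bijection_ival nu2L _ (xL _ tL). Qed.

(** [M] bounds only the tail of [g] from [nu1 t] on. The two terms on the right come from the two
    summands of [le_bound]. *)
Lemma iterated_le (B t : R) (M : \bar R) : ival L t -> (0 <= B)%R ->
  (forall x, ival L x -> primitive w x <= (B * (x * w x))%:E) ->
  0 <= M -> (forall s, ival L s -> (nu1 t <= s)%R -> g s <= M) ->
  Rop u1 v1 nu1 (rearrangement L g) t <=
  B%:E * Rop u2 v nu h t + (B * (v1 t * (nu1 t * u1 (nu1 t))))%:E * M.
Proof.
move=> tL B0 wB M0 gM; set x := nu1 t; have xxL : ival L x := xL _ tL.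
set f := F (nu2 x).
have f0 : 0 <= f by apply: hardy_ge0; exact: nuL.
have x0 := xxL.1.
(* A superlevel set of [g] at a level above this bound lies in (0, s): between [s] and [x] both [v2]
   and [F] are estimated by monotonicity, and from [x] on [M] takes over. *)
have le_bound s : ival L s -> (s < x)%R -> rearrangement L g s <= (v2 s)%:E * f + M.
  move=> sL sx; have b0 : 0 <= (v2 s)%:E * f by rewrite mule_ge0// lee_fin ltW// v2_gt0.
  apply: rearrangement_le => [|m m0 bm]; first exact: adde_ge0.
  have -> : s%:E = leb (`]0%R, s[ : set (lebesgueType R)).
    by rewrite leb_oo ?subr0// ltW// sL.1.
  apply: leb_le => r [rL]; rewrite gee0_abs ?g_ge0// => mg /=.
  rewrite in_itv/= rL.1/= ltNge; apply/negP => sr.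
  move: mg; apply/negP; rewrite -leNgt; apply: le_trans bm.
  have [xr|rx] := leP x r; first by apply: (le_trans (gM _ rL xr)); rewrite leeDr.
  apply: (@le_trans _ _ ((v2 s)%:E * f)); last by rewrite leeDl.
  have nurL := increasing_bijection_ival nu2L _ rL.
  apply: lee_pmul; rewrite ?lee_fin.
  - by rewrite ltW// v2_gt0.
  - exact: hardy_ge0.
  - exact: v2_nonincreasing.
  - apply: hardy_le => //; first exact: nuL.
    by apply: (increasing_bijection_le nu2L) => //; exact: ltW.
have w_gt0 s : ival L s -> (0 < w s)%R by move=> sL; rewrite mulr_gt0 ?u1_gt0 ?v2_gt0.
have mI : measurable (`]0%R, x[%classic : set (lebesgueType R)).
  by apply: lmeasurable_interval; exact: interval_is_interval.
have mw : measurable_fun (`]0%R, x[ : set (lebesgueType R))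
    (fun s : lebesgueType R => (w s)%:E).
  apply: (@lmeasurable_fun_sub _ _ (EFin \o w) _ (oo_ival_in xxL)).
  apply: nonincreasing_lmeasurable => r s rL sL rs; rewrite lee_fin.
  apply: ler_pM; [by rewrite ltW// u1_gt0|by rewrite ltW// v2_gt0| |exact: v2_nonincreasing].
  exact: u1_ni.
have mu1 : measurable_fun (`]0%R, x[ : set (lebesgueType R))
    (fun s : lebesgueType R => (u1 s)%:E).
  apply: (@lmeasurable_fun_sub _ _ (EFin \o u1) _ (oo_ival_in xxL)).
  exact: nonincreasing_lmeasurable.
(* Since [v2] is nonincreasing, [u1 <= w / v2 x] on (0, x), so the averaging bound for [w] passes to
   [u1]. *)
have Iu1 : \int[leb]_(s in `]0%R, x[) (u1 s)%:E <= (B * (x * u1 x))%:E.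
  apply: (@le_trans _ _ (((v2 x)^-1)%:E * primitive w x)).
    rewrite -ge0_integralZl//.
    - apply: ge0_le_integral_subset => // s /[dup] /(oo_ival_in xxL) sL.
      + by rewrite lee_fin ltW// u1_gt0.
      + by rewrite -EFinM lee_fin ltW// mulr_gt0 ?invr_gt0 ?v2_gt0 ?w_gt0.
      + rewrite /= in_itv/= => /andP[_ sx].
        rewrite -EFinM lee_fin /w mulrCA ler_peMr//; first by rewrite ltW// u1_gt0.
        rewrite mulrC ler_pdivlMr ?v2_gt0// mul1r.
        by apply: v2_nonincreasing => //; exact: ltW.
    - by move=> s /(oo_ival_in xxL) sL; rewrite lee_fin ltW// w_gt0.
    - by rewrite lee_fin invr_ge0 ltW// v2_gt0.
  have v2x0 := v2_gt0 _ xxL.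
  apply: (@le_trans _ _ (((v2 x)^-1)%:E * (B * (x * w x))%:E)).
    by apply: lee_wpmul2l; [rewrite lee_fin invr_ge0 ltW|exact: wB].
  rewrite -EFinM lee_fin le_eqVlt; apply/orP; left; apply/eqP.
  by rewrite /w; field; rewrite gt_eqF.
apply: (@le_trans _ _ ((v1 t)%:E *
    (f * (B * (x * w x))%:E + M * (B * (x * u1 x))%:E))); last first.
  have v1t0 := v1_gt0 _ tL; have u1x0 := u1_gt0 _ xxL; have wx0 := w_gt0 _ xxL.
  have c1 : (0 <= B * (x * w x))%R by apply: mulr_ge0 => //; rewrite ltW// mulr_gt0.
  have c2 : (0 <= B * (x * u1 x))%R by apply: mulr_ge0 => //; rewrite ltW// mulr_gt0.
  rewrite ge0_muleDr; [|by rewrite mule_ge0|by rewrite mule_ge0].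
  rewrite /Rop -/(F _) -/f -/x; apply: leeD.
    rewrite [f * _]muleC !muleA -!EFinM; apply: lee_wpmul2r => //.
    by rewrite lee_fin /v -/x /w le_eqVlt; apply/orP; left; apply/eqP; ring.
  rewrite [M * _]muleC muleA -EFinM; apply: lee_wpmul2r => //.
  by rewrite lee_fin le_eqVlt; apply/orP; left; apply/eqP; ring.
apply: lee_wpmul2l; first by rewrite lee_fin ltW// v1_gt0.
apply: (@le_trans _ _ (\int[leb]_(s in `]0%R, x[) (f * (w s)%:E + M * (u1 s)%:E))).
  apply: ge0_le_integral_subset => // s /[dup] /(oo_ival_in xxL) sL.
  - by rewrite mule_ge0// lee_fin ltW// u1_gt0.
  - by rewrite adde_ge0// mule_ge0// lee_fin ltW// ?u1_gt0 ?w_gt0.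
  - rewrite /= in_itv/= => /andP[_ sx]; rewrite abse_rearrangement.
    apply: (@le_trans _ _ (((v2 s)%:E * f + M) * (u1 s)%:E)).
      by apply: lee_wpmul2r; [rewrite lee_fin ltW// u1_gt0|exact: le_bound].
    rewrite ge0_muleDl//; last by rewrite mule_ge0// lee_fin ltW// v2_gt0.
    by rewrite /w EFinM muleAC muleC [(u1 s)%:E * (v2 s)%:E]muleC.
rewrite ge0_integral_lincomb//; last 2 first.
- by move=> s /(oo_ival_in xxL) sL; rewrite lee_fin ltW// w_gt0.
- by move=> s /(oo_ival_in xxL) sL; rewrite lee_fin ltW// u1_gt0.
by apply: leeD; apply: lee_wpmul2l => //; exact: wB.
Qed.

(** * Consequences of the conditions on [eta] *)

Section eta.
Variable eta : R -> \bar R.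
Hypothesis etaE : forall t, ival L t ->
  eta (nu t) = (primitive u2 (nu t) * (v t)%:E)^-1.
(** Real-valued versions of [U2] and [eta]; they exist when [U2] is finite on (0, L). *)
Variables U e : R -> R.
Hypothesis UE : forall t, ival L t -> primitive u2 t = (U t)%:E.
Hypothesis eE : forall t, ival L t -> eta t = (e t)%:E.
Variables a1 b1 a2 b2 C1 C2 : R.
Hypotheses (a1_gt0 : (0 < a1)%R) (b1_gt0 : (0 < b1)%R).
Hypotheses (a2_gt0 : (0 < a2)%R) (b2_gt0 : (0 < b2)%R).
Hypotheses (C1_gt0 : (0 < C1)%R) (C2_gt0 : (0 < C2)%R).
Hypothesis eta_equiv : equiv_nonincreasing L a1 b1 eta.
Hypothesis eta_xi_equiv : equiv_nonincreasing L a2 b2 (fun t => eta t / (xi t)%:E).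
Hypothesis eta_int : \forall t \ae @completed_lebesgue_measure R, ival L t ->
  \int[leb]_(s in `]0%R, t[) (eta s * (u2 s)%:E) <= C1%:E * primitive u2 t * eta t.
Hypothesis U2v_int : \forall t \ae @completed_lebesgue_measure R, ival L t ->
  (t^-1)%:E * \int[leb]_(s in `]0%R, t[) (primitive u2 (nu s) * (v s)%:E)
    >= C2%:E * primitive u2 (nu t) * (v t)%:E.

Let v_gt0 t : ival L t -> (0 < v t)%R.
Proof.
by move=> tL; rewrite /v !mulr_gt0 ?u1_gt0 ?v1_gt0 ?v2_gt0//; [exact: (xL t tL).1|exact: xL..].
Qed.

Let mu2 : lmeasurable_fun L (EFin \o u2).
Proof. exact: nonincreasing_lmeasurable. Qed.

Let U_gt0 t : ival L t -> (0 < U t)%R.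
Proof. by move=> tL; rewrite -lte_fin -UE//; exact: primitive_gt0 u2_gt0 u2_ni tL. Qed.

Let U_average a b : ival L a -> ival L b -> (a <= b)%R -> (a * U b <= b * U a)%R.
Proof.
move=> aL bL ab; rewrite -lee_fin !EFinM -!UE//.
by apply: (average_le (L := L) (EFin \o u2)) => // s sL; rewrite lee_fin ltW// u2_gt0.
Qed.

Let nuS y : ival L y -> exists2 t, ival L t & nu t = y.
Proof.
have [[_ _ surj] _] := increasing_bijection_comp nu1L nu2L.
by move=> /surj[t tL <-]; exists t.
Qed.

Let e_nu t : ival L t -> e (nu t) = ((U (nu t) * v t)^-1)%R.
Proof.
move=> tL; have m0 : (0 < U (nu t) * v t)%R.
  by rewrite mulr_gt0 ?v_gt0// U_gt0//; exact: nuL.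
apply: EFin_inj.
by rewrite -(eE _ (nuL _ tL)) etaE// (UE _ (nuL _ tL)) -EFinM inver gt_eqF.
Qed.

Let e_gt0 t : ival L t -> (0 < e t)%R.
Proof.
move=> /nuS[s sL <-]; rewrite e_nu// invr_gt0 mulr_gt0 ?v_gt0// U_gt0//.
exact: nuL.
Qed.

Let e_ni s t : ival L s -> ival L t -> (s <= t)%R -> (e t <= b1 / a1 * e s)%R.
Proof.
move=> sL tL st; have [h1 [h10 h1ni h1e]] := eta_equiv.
have [_ et] := h1e _ tL; have [es _] := h1e _ sL.
rewrite mulrAC -mulrA -lee_fin -(eE _ tL).
apply: (le_trans et); rewrite EFinM; apply: lee_wpmul2l; first by rewrite lee_fin ltW.
rewrite mulrC EFinM -(eE _ sL) lee_pdivlMl//.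
apply: le_trans es; apply: lee_wpmul2l; first by rewrite lee_fin ltW.
exact: h1ni.
Qed.

Let Xi_ge0 t : ival L t -> 0 <= primitive xi t.
Proof. by move=> tL; apply: (primitive_ge0 _ _ xi_gt0); exact: ltW tL.2. Qed.

(** The first factor is the constant of [step1] below, the second that of [step3]. *)
Let C := (b1 * b2 / a1 * (2 * C1 * b1 / a1 / a2))%R.

(** Both [U S * e S] and [U T * e T] are compared with integrals of [eta * u2]. Writing [eta * u2]
    as [eta / xi * u2] times [xi], with [eta / xi] replaced by the nonincreasing [h2], makes these
    integrals comparable to those of the nonincreasing [k] against [xi], to which
    [weighted_average_le] applies. *)
Lemma Ueta_average_le S T : ival L S -> ival L T -> (T <= S)%R ->
  primitive xi T * (U S * e S)%:E <= primitive xi S * (C * (U T * e T))%:E.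
Proof.
move=> SL TL TS; have [h2 [h20 h2ni h2e]] := eta_xi_equiv.
pose k s := h2 s * (u2 s)%:E.
have k0 s : ival L s -> 0 <= k s.
  by move=> sL; rewrite mule_ge0 ?h20// lee_fin ltW// u2_gt0.
have kni : nonincreasing_on L k.
  move=> s t sL tL st; apply: lee_pmul; [exact: h20| |exact: h2ni|exact: u2_ni].
  by rewrite lee_fin ltW// u2_gt0.
have mk : lmeasurable_fun L (fun s => k s * (xi s)%:E).
  by apply: emeasurable_funM; [exact: nonincreasing_lmeasurable|exact: mxi].
have kxi0 s : ival L s -> 0 <= k s * (xi s)%:E.
  by move=> sL; rewrite mule_ge0 ?k0// lee_fin ltW// xi_gt0.
have eta_le s : ival L s -> eta s <= b2%:E * (h2 s * (xi s)%:E).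
  move=> sL; have [_] := h2e _ sL; have xis := xi_gt0 _ sL.
  by rewrite inver gt_eqF// lee_pdivrMr// muleA.
have eta_ge s : ival L s -> a2%:E * (h2 s * (xi s)%:E) <= eta s.
  move=> sL; have [+ _] := h2e _ sL; have xis := xi_gt0 _ sL.
  by rewrite inver gt_eqF// lee_pdivlMr// muleA.
have c0 : (0 < b1 * b2 / a1)%R by rewrite divr_gt0 ?mulr_gt0.
have mI t : measurable (`]0%R, t[%classic : set (lebesgueType R)).
  by apply: lmeasurable_interval; exact: interval_is_interval.
(* On (0, S) the function [eta] is at least a multiple of [e S], and [u2] integrates to [U S]. *)
have step1 : (U S * e S)%:E <=
    (b1 * b2 / a1)%:E * \int[leb]_(s in `]0%R, S[) (k s * (xi s)%:E).
  rewrite mulrC EFinM -UE//.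
  apply: (@le_trans _ _ (\int[leb]_(s in `]0%R, S[)
      ((b1 * b2 / a1)%:E * (k s * (xi s)%:E)))); last first.
    apply: ge0_le_scale_integral.
    - exact: mI.
    - by rewrite lee_fin ltW.
    - by move=> s /(oo_ival_in SL) sL; apply: mule_ge0; [rewrite lee_fin ltW|exact: kxi0].
    - by move=> s /(oo_ival_in SL); exact: kxi0.
    - exact: (lmeasurable_fun_sub (oo_ival_in SL) mk).
    - by [].
  apply: ge0_scale_integral_le.
  - exact: mI.
  - by [].
  - by rewrite lee_fin ltW// e_gt0.
  - by move=> s /(oo_ival_in SL) sL; rewrite lee_fin ltW// u2_gt0.
  - exact: (lmeasurable_fun_sub (oo_ival_in SL) mu2).
  - by move=> s /(oo_ival_in SL) sL; apply: mule_ge0; [rewrite lee_fin ltW|exact: kxi0].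
  move=> s /[dup] /(oo_ival_in SL) sL; rewrite /= in_itv/= => /andP[_ sS].
  rewrite /k muleAC muleA; apply: lee_wpmul2r.
    by rewrite lee_fin ltW// u2_gt0.
  apply: (@le_trans _ _ ((b1 / a1)%:E * eta s)).
    by rewrite (eE _ sL) -EFinM lee_fin; apply: e_ni => //; exact: ltW.
  rewrite (_ : (b1 * b2 / a1)%:E = (b1 / a1)%:E * b2%:E); last first.
    by rewrite -EFinM; congr (_%:E); ring.
  rewrite -muleA; apply: lee_wpmul2l; last exact: eta_le.
  by rewrite lee_fin ltW// divr_gt0.
(* The a.e. bound is read off at some [T'] in (T, 2T). Returning to [T] costs a factor 2, as
   [U z / z] is nonincreasing, and [b1 / a1] for [e]. *)
have [T' [TT' T'T T'L HT']] := ae_exists_right _ _ 2%R ltac:(lra) TL eta_int.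
have step2 : a2%:E * \int[leb]_(s in `]0%R, T[) (k s * (xi s)%:E) <=
    (2 * C1 * b1 / a1 * (U T * e T))%:E.
  apply: (@le_trans _ _ (\int[leb]_(s in `]0%R, T'[) (eta s * (u2 s)%:E))).
    apply: ge0_scale_integral_le.
    - exact: mI.
    - by move=> s /=; rewrite !in_itv/= => /andP[-> /lt_trans->].
    - by rewrite lee_fin ltW.
    - by move=> s /(oo_ival_in TL); exact: kxi0.
    - exact: (lmeasurable_fun_sub (oo_ival_in TL) mk).
    - move=> s /(oo_ival_in T'L) sL; rewrite (eE _ sL) -EFinM lee_fin ltW//.
      by rewrite mulr_gt0 ?u2_gt0 ?e_gt0.
    - move=> s /(oo_ival_in TL) sL; rewrite /k muleAC muleA.
      by apply: lee_wpmul2r; [rewrite lee_fin ltW// u2_gt0|exact: eta_ge].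
  apply: (le_trans HT'); rewrite (eE _ T'L) UE// -!EFinM lee_fin.
  have UT' : (U T' <= 2 * U T)%R.
    have T0 := TL.1; have UT0 := U_gt0 _ TL.
    rewrite -(ler_pM2l T0); apply: (le_trans (U_average _ _ TL T'L (ltW TT'))).
    by rewrite mulrCA mulrA ler_pM2r// ltW.
  have eT' := e_ni _ _ TL T'L (ltW TT').
  apply: (@le_trans _ _ (C1 * (2 * U T) * (b1 / a1 * e T)))%R.
    apply: ler_pM => //; [|exact: ltW (e_gt0 _ T'L)|].
      by rewrite mulr_ge0 ?(ltW C1_gt0) ?(ltW (U_gt0 _ T'L)).
    by rewrite ler_pM2l.
  by rewrite le_eqVlt; apply/orP; left; apply/eqP; ring.
have step3 : \int[leb]_(s in `]0%R, T[) (k s * (xi s)%:E) <=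
    (2 * C1 * b1 / a1 / a2 * (U T * e T))%:E.
  have -> : (2 * C1 * b1 / a1 / a2 * (U T * e T) =
      a2^-1 * (2 * C1 * b1 / a1 * (U T * e T)))%R.
    by move: (U T * e T)%R => z; ring.
  by rewrite EFinM lee_pdivlMl.
have wavg := weighted_average_le L k xi k0 kni xi_gt0 mxi T S TL SL TS.
apply: (@le_trans _ _ (primitive xi T *
    ((b1 * b2 / a1)%:E * \int[leb]_(s in `]0%R, S[) (k s * (xi s)%:E)))).
  by apply: lee_wpmul2l => //; exact: Xi_ge0.
rewrite muleCA; apply: (@le_trans _ _ ((b1 * b2 / a1)%:E * (primitive xi S *
    \int[leb]_(s in `]0%R, T[) (k s * (xi s)%:E)))).
  by apply: lee_wpmul2l => //; rewrite lee_fin ltW.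
rewrite muleCA; apply: lee_wpmul2l; first exact: Xi_ge0.
have -> : (C * (U T * e T) =
    b1 * b2 / a1 * (2 * C1 * b1 / a1 / a2 * (U T * e T)))%R by rewrite /C -!mulrA.
rewrite [leRHS]EFinM; apply: lee_wpmul2l; last exact: step3.
by rewrite lee_fin ltW.
Qed.

(** At the point [nu s], the product [U * e] is [1 / v s] and the primitive of [xi] is
    [1 / v2 (nu1 s)], so this is [Ueta_average_le] rearranged. *)
Lemma v2_div_v_le s t : ival L s -> ival L t -> (t <= s)%R ->
  (v2 (nu1 s) / v s <= C * (v2 (nu1 t) / v t))%R.
Proof.
move=> sL tL ts.
have nuts := increasing_bijection_le (increasing_bijection_comp nu1L nu2L) _ _ tL sL ts.
have := Ueta_average_le _ _ (nuL _ sL) (nuL _ tL) nuts.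
rewrite !e_nu// /nu /= -(v2E _ (xL _ sL)) -(v2E _ (xL _ tL)) -/(nu s) -/(nu t).
rewrite -!EFinM lee_fin.
have [vs vt] := (v_gt0 _ sL, v_gt0 _ tL).
have [vs2 vt2] := (v2_gt0 _ (xL _ sL), v2_gt0 _ (xL _ tL)).
have [us ut] := (U_gt0 _ (nuL _ sL), U_gt0 _ (nuL _ tL)).
have UV (x y : R) : (0 < x -> 0 < y -> x * (x * y)^-1 = y^-1)%R.
  by move=> x0 y0; rewrite invfM mulrA divff ?mul1r// gt_eqF.
rewrite !UV// => H.
rewrite -(ler_pM2r (_ : (0 < (v2 (nu1 t))^-1 * (v2 (nu1 s))^-1)%R)); last first.
  by rewrite mulr_gt0// invr_gt0.
apply: le_trans (le_trans _ H) _; rewrite le_eqVlt; apply/orP; left; apply/eqP.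
  by field; rewrite !gt_eqF.
by field; rewrite !gt_eqF.
Qed.

Let B := (b1 / a1)%R.
(** On (0, L), [m] is the reciprocal of [e \o nu], hence almost nondecreasing with constant [B]. *)
Let m t := (U (nu t) * v t)%R.
Let delta := (C2 / (2 * B))%R.
Let phi := Rop u2 v nu h.

Let B_gt0 : (0 < B)%R. Proof. by rewrite divr_gt0. Qed.

Let delta_gt0 : (0 < delta)%R. Proof. by rewrite divr_gt0// mulr_gt0. Qed.

Let m_gt0 t : ival L t -> (0 < m t)%R.
Proof. by move=> tL; rewrite mulr_gt0 ?v_gt0 ?U_gt0//; exact: nuL. Qed.

Let m_nd s t : ival L s -> ival L t -> (s <= t)%R -> (m s <= B * m t)%R.
Proof.
move=> sL tL st.
have nust := increasing_bijection_le (increasing_bijection_comp nu1L nu2L) _ _ sL tL st.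
have := e_ni _ _ (nuL _ sL) (nuL _ tL) nust.
rewrite !e_nu// -/(m s) -/(m t) -/B => H.
have ms := m_gt0 _ sL; have mt := m_gt0 _ tL.
by move: H; rewrite ler_pdivlMr// ler_pdivrMl// mulrC.
Qed.

Hypothesis mv : lmeasurable_fun L (EFin \o v).

Let mm : lmeasurable_fun L (EFin \o m).
Proof.
have -> : (EFin \o m) = (fun t => (U (nu t))%:E * (EFin \o v) t).
  by apply/funext => t; rewrite /= EFinM.
apply: emeasurable_funM; last exact: mv.
apply: nondecreasing_lmeasurable => s t sL tL st.
rewrite -(UE _ (nuL _ sL)) -(UE _ (nuL _ tL)).
have nust := increasing_bijection_le (increasing_bijection_comp nu1L nu2L) _ _ sL tL st.
apply: ge0_le_integral_subset => //.
- by move=> x /=; rewrite !in_itv/= => /andP[-> /lt_le_trans->].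
- by move=> x /(oo_ival_in (nuL _ sL)) ?; rewrite lee_fin ltW// u2_gt0.
- by move=> x /(oo_ival_in (nuL _ tL)) ?; rewrite lee_fin ltW// u2_gt0.
Qed.

(* The [r < s] at which the almost nondecreasing function [m] is at least
   comparable to [m s]. *)
Let E (s : R) : set (lebesgueType R) :=
  superlevel L (EFin \o m) (C2 / 2 * m s)%R `&` `]0%R, s[.

Let mE s : measurable (E s).
Proof.
apply: measurableI; first exact: measurable_superlevel.
by apply: lmeasurable_interval; exact: interval_is_interval.
Qed.

(** On (0, s), [m] is at most [C2 / 2 * m s] off [E s] and at most [B * m s] on it, yet its average
    is at least [C2 * m s]. So [E s] must contribute at least half of this, which gives the
    proportion [delta]. *)
Let leb_E s : ival L s ->
  C2%:E * primitive u2 (nu s) * (v s)%:E <=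
  (s^-1)%:E * \int[leb]_(r in `]0%R, s[) (primitive u2 (nu r) * (v r)%:E) ->
  (delta * s)%:E <= leb (E s).
Proof.
move=> sL; have s0 := sL.1; have ms0 := m_gt0 _ sL.
rewrite lee_pdivlMl// (UE _ (nuL _ sL)) -!EFinM => H.
have mI : measurable (`]0%R, s[%classic : set (lebesgueType R)).
  by apply: lmeasurable_interval; exact: interval_is_interval.
have leb_fin : leb (E s) \is a fin_num.
  rewrite ge0_fin_numE//; apply: (@le_lt_trans _ _ s%:E); last by rewrite ltry.
  rewrite -[X in X%:E]subr0 -(leb_oo _ _ (ltW s0)).
  by apply: leb_le => r [].
have c0 : (0 < C2 / 2 * m s)%R by rewrite mulr_gt0// divr_gt0.
have Bm0 : (0 < B * m s)%R by rewrite mulr_gt0.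
have : \int[leb]_(r in `]0%R, s[) (primitive u2 (nu r) * (v r)%:E) <=
    \int[leb]_(r in `]0%R, s[) ((C2 / 2 * m s)%:E + (B * m s)%:E * (\1_(E s) r)%:E).
  apply: ge0_le_integral_subset => // r /[dup] /(oo_ival_in sL) rL.
  - by rewrite (UE _ (nuL _ rL)) -EFinM lee_fin ltW// m_gt0.
  - by rewrite adde_ge0 ?mule_ge0// lee_fin ltW.
  - move=> rs; rewrite (UE _ (nuL _ rL)) -!EFinM -EFinD lee_fin -/(m r) indicE.
    case: (boolP (r \in E s)) => [_|rE] /=.
      rewrite mulr1; apply: (@le_trans _ _ (B * m s))%R; last by rewrite lerDr ltW.
      by apply: m_nd => //; move: rs; rewrite /= in_itv/= => /andP[_ /ltW].
    rewrite mulr0 addr0 leNgt; apply/negP => mr.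
    move: rE; rewrite notin_setE; apply; split => //; split => //=.
    by rewrite ger0_norm ?lte_fin// ltW// m_gt0.
have -> : \int[leb]_(r in `]0%R, s[)
      ((C2 / 2 * m s)%:E + (B * m s)%:E * (\1_(E s) r)%:E) =
    (C2 / 2 * m s)%:E * leb (`]0%R, s[ : set (lebesgueType R)) +
    (B * m s)%:E * leb (E s).
  by apply: integral_cst_indic; [exact: mI|exact: mE|move=> r []|exact: ltW|exact: ltW].
rewrite leb_oo ?subr0 ?(ltW s0)// -(fineK leb_fin) -!EFinM -EFinD.
move=> /(le_trans H); rewrite !lee_fin -/(m s) => {}H.
have : (s * (C2 * m s) <= C2 / 2 * m s * s + B * m s * fine (leb (E s)))%R.
  by move: H; rewrite /m !mulrA.
rewrite -lerBlDl.
have -> : (s * (C2 * m s) - C2 / 2 * m s * s = B * m s * (delta * s))%R.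
  by rewrite /delta; field; rewrite gt_eqF.
by rewrite ler_pM2l.
Qed.

(** The function [phi] is [m] times the [u2]-average of [|h|] over (0, nu r). That average is
    nonincreasing and [m] is large on a set of measure at least [delta / 2 * s] in (0, s), which
    exceeds [t / 2 ^+ k]. *)
Lemma rearrangement_hardy_ge (k : nat) s t : (2 < delta * 2 ^+ k)%R ->
  ival L s -> ival L t -> (t <= s)%R ->
  (C2 / 2 / B)%:E * phi s <= rearrangement L phi (t / 2 ^+ k).
Proof.
move=> kdelta sL tL ts; have s0 := sL.1.
(* [leb_E] is available only at almost every point, so it is applied at [s'] slightly beyond [s].
   Cutting [E s'] back to (0, s) loses at most [delta / 2 * s], half of the guaranteed measure. *)
have d1 : (1 < 1 + delta / 2)%R by rewrite ltrDl divr_gt0.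
have [s' [ss' s's s'L Hs']] := ae_exists_right _ _ _ d1 sL U2v_int.
have HE := leb_E _ s'L Hs'.
have mI : measurable (`]0%R, s[%classic : set (lebesgueType R)).
  by apply: lmeasurable_interval; exact: interval_is_interval.
have mEs : measurable (E s' `&` `]0%R, s[) by exact: measurableI.
have leb_Es : (delta / 2 * s)%:E <= leb (E s' `&` `]0%R, s[).
  have sub : leb (E s') <= leb (E s' `&` `]0%R, s[) + (s' - s)%:E.
    have leb_co : leb (`[s, s'[ : set (lebesgueType R)) = (s' - s)%:E.
      by rewrite leb_itv/= lte_fin ss'.
    rewrite -leb_co; apply: (le_trans (leb_le _ ((E s' `&` `]0%R, s[) `|` `[s, s'[) _)).
      move=> r rE; have [_] := rE; rewrite /= !in_itv/= => /andP[r0 rs'].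
      have [rs|sr] := ltP r s; [by left; rewrite r0|].
      by right.
    apply: measureU2 => //.
    by apply: lmeasurable_interval; exact: interval_is_interval.
  have := le_trans HE sub.
  rewrite -leeBlDr// -EFinB => H; apply: le_trans H; rewrite lee_fin.
  have : (delta * s <= delta * s')%R by rewrite ler_pM2l// ltW.
  have -> : (delta / 2 * s = delta * s - (1 + delta / 2 - 1) * s)%R by field.
  by rewrite mulrBl mul1r; lra.
apply: rearrangement_ge => l l0 lphi.
apply: (@lt_le_trans _ _ (delta / 2 * s)%:E).
  rewrite lte_fin ltr_pdivrMr ?exprn_gt0//.
  apply: (le_lt_trans ts); rewrite mulrAC ltr_pMl//; lra.
apply: (le_trans leb_Es); apply: leb_le => r [[[rL mr] _] ].
rewrite /= in_itv/= => /andP[_ rs]; split => //; apply: (lt_le_trans lphi).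
have Fs0 := hardy_ge0 _ (nuL _ sL); have Fr0 := hardy_ge0 _ (nuL _ rL).
have vr0 := v_gt0 _ rL; have vs0 := v_gt0 _ sL.
have phir : `|phi r| = phi r by rewrite gee0_abs// mule_ge0// lee_fin ltW.
rewrite phir.
have nurs := increasing_bijection_le (increasing_bijection_comp nu1L nu2L) _ _ rL sL (ltW rs).
have k0 x : ival L x -> 0 <= `|h x| by [].
have kni : nonincreasing_on L (fun x => `|h x|).
  by move=> x y xxL yL xy; rewrite !gee0_abs//; exact: h_ni.
have := weighted_average_le L _ u2 k0 kni u2_gt0 mu2 _ _ (nuL _ rL) (nuL _ sL) nurs.
rewrite (UE _ (nuL _ rL)) (UE _ (nuL _ sL)) -/(F _) -/(F _) => FF.
have Us0 := U_gt0 _ (nuL _ sL).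
have Us0' : 0 < (U (nu s))%:E by rewrite lte_fin.
rewrite -(lee_pmul2l _ Us0')//.
apply: (@le_trans _ _ ((v r)%:E * ((U (nu r))%:E * F (nu s)))); last first.
  rewrite /phi /Rop -/(F _) [leRHS]muleCA; apply: lee_wpmul2l => //.
  by rewrite lee_fin ltW.
rewrite /phi /Rop -/(F _) !muleA -!EFinM; apply: lee_wpmul2r => //.
(* What remains compares [m r] with [m s]: membership in [E s'] gives [C2 / 2 * m s'], and passing
   from [s'] to [s] costs [B]. *)
rewrite lee_fin [leRHS]mulrC -/(m r).
have ms := m_nd _ _ sL s'L (ltW ss').
move: mr; rewrite /= lte_fin ger0_norm; last by rewrite ltW// m_gt0.
move=> /ltW; apply: le_trans.
have -> : (U (nu s) * (C2 / 2 / B) * v s = C2 / 2 / B * m s)%R by rewrite /m; ring.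
rewrite -[X in (X <= _)%R]mulrA ler_pM2l ?divr_gt0//.
by rewrite mulrC ler_pdivrMr// mulrC.
Qed.

End eta.

End hardy.

(** * Measurability of the operators and finiteness of primitives *)

Lemma continuous_lmeasurable {R : realType} {L : \bar R} {f : R -> R} :
  {within ival L, continuous f} -> lmeasurable_fun L (EFin \o f).
Proof.
move=> fc; apply/measurable_EFinP => mD Y mY; apply: lmeasurable_borel.
have mI : measurable (ival L : set (measurableTypeR R)).
  by apply: is_interval_measurable; exact: ival_interval.
exact: (subspace_continuous_measurable_fun mI fc mI mY).
Qed.

Lemma lmeasurableM {R : realType} {L : \bar R} {f g : R -> R} :
  lmeasurable_fun L (EFin \o f) -> lmeasurable_fun L (EFin \o g) ->
  lmeasurable_fun L (EFin \o (fun t => f t * g t)%R).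
Proof.
move=> mf mg.
have -> : EFin \o (fun t => f t * g t)%R = (fun t => (EFin \o f) t * (EFin \o g) t).
  by apply/funext => t; rewrite /= EFinM.
exact: emeasurable_funM mf mg.
Qed.

Lemma Mplus_Rop {R : realType} {L : \bar R} {u v nu : R -> R} (k : R -> \bar R) :
  increasing_bijection L nu -> positive_on L u -> positive_on L v ->
  lmeasurable_fun L (EFin \o v) -> Mplus L (Rop u v nu k).
Proof.
move=> nuL u0 v0 mv.
have sub t : ival L t -> `]0%R, nu t[ `<=` ival L.
  by move=> tL; apply: oo_ival_in; exact: increasing_bijection_ival nuL _ tL.
have pos t s : ival L t -> `]0%R, nu t[%classic s -> 0 <= `|k s| * (u s)%:E.
  by move=> tL /(sub _ tL) sL; rewrite mule_ge0// lee_fin ltW// u0.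
apply: Mplus_ge0 => [|t tL].
  apply: emeasurable_funM; first exact: mv.
  apply: nondecreasing_lmeasurable => s t sL tL st.
  have nust := increasing_bijection_le nuL _ _ sL tL st.
  apply: ge0_le_integral_subset => [x|x|x|//]; [|exact: pos|exact: pos].
  by rewrite /= !in_itv/= => /andP[-> /lt_le_trans->].
apply: mule_ge0; first by rewrite lee_fin ltW// v0.
by apply: integral_ge0 => s; exact: pos.
Qed.

(** To the left of [t] the primitive is smaller, and to the right it grows at most linearly because
    its averages decrease. Hence [U2] is finite everywhere or infinite everywhere on (0, L). *)
Lemma primitive_lty {R : realType} {L : \bar R} {u : R -> R} (t s : R) :
  positive_on L u -> nonincreasing_on L (EFin \o u) -> ival L t -> ival L s ->
  primitive u t < +oo -> primitive u s < +oo.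
Proof.
move=> u0 uni tL sL; have [st|ts] := leP s t.
  apply: le_lt_trans; apply: ge0_le_integral_subset => [x|x|x|//].
  - by rewrite /= !in_itv/= => /andP[-> /lt_le_trans->].
  - by move=> /(oo_ival_in sL) xL; rewrite lee_fin ltW// u0.
  - by move=> /(oo_ival_in tL) xL; rewrite lee_fin ltW// u0.
have u_ge0 x : ival L x -> 0 <= (EFin \o u) x by move=> xL; rewrite lee_fin ltW// u0.
have := average_le _ _ _ u_ge0 uni tL sL (ltW ts).
rewrite -/(primitive u s) -/(primitive u t) => H tfin.
have {H} : primitive u s <= (t^-1)%:E * (s%:E * primitive u t).
  by rewrite lee_pdivlMl ?tL.1.
move=> /le_lt_trans; apply; rewrite muleA -EFinM lte_mul_pinfty//.
  by rewrite lee_fin mulr_ge0 ?invr_ge0// ltW ?tL.1 ?sL.1.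
Qed.

(** * The upper bound, for infinite and for finite [U2] *)

Section iterated_upper.
Context {R : realType} {L : \bar R} {nu1 nu2 u1 u2 v1 v2 xi : R -> R}.
Hypotheses (nu1L : increasing_bijection L nu1) (nu2L : increasing_bijection L nu2).
Hypotheses (u1_gt0 : positive_on L u1) (u1_ni : nonincreasing_on L (EFin \o u1)).
Hypotheses (u2_gt0 : positive_on L u2) (u2_ni : nonincreasing_on L (EFin \o u2)).
Hypotheses (v1_gt0 : positive_on L v1) (xi_gt0 : positive_on L xi).
Hypothesis mxi : lmeasurable_fun L (EFin \o xi).
Hypothesis v2_gt0 : positive_on L v2.
Hypothesis v2E : forall t, ival L t -> ((v2 t)^-1)%:E = primitive xi (nu2 t).
Let nu := nu2 \o nu1.
Let v t := (nu1 t * u1 (nu1 t) * v1 t * v2 (nu1 t))%R.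
Hypothesis mv : lmeasurable_fun L (EFin \o v).
Variable h : R -> \bar R.
Hypothesis h_ge0 : forall t, 0 <= h t.
Hypothesis h_ni : nonincreasing_on L h.
Variable B : R.
Hypothesis B_gt0 : (0 < B)%R.
Hypothesis avg : forall x, ival L x ->
  primitive (fun s => u1 s * v2 s)%R x <= (B * (x * (u1 x * v2 x)))%:E.

Let g := Rop u2 v2 nu2 h.
Let phi := Rop u2 v nu h.

Let v_gt0 t : ival L t -> (0 < v t)%R.
Proof.
move=> tL; have xL := increasing_bijection_ival nu1L _ tL.
by rewrite /v !mulr_gt0 ?u1_gt0 ?v1_gt0 ?v2_gt0//; exact: xL.1.
Qed.

Let nu_ival t : ival L t -> ival L (nu t).
Proof. exact: increasing_bijection_ival (increasing_bijection_comp nu1L nu2L) t. Qed.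

(* When [U2] is infinite, [eta] vanishes and carries no information. *)
Lemma iterated_le_infinite t : (forall s, ival L s -> primitive u2 s = +oo) ->
  ival L t -> Rop u1 v1 nu1 (rearrangement L g) t <= B%:E * phi t.
Proof.
move=> U2oo tL.
(* If [h] vanishes on (0, L), then [g] does too and [iterated_le] applies with the tail bound 0.
   Otherwise [h] is bounded below by a positive constant near 0, where [u2] has infinite integral,
   and the right-hand side is infinite. *)
have [h_eq0|/existsNP[a /not_implyP[aL ha]]] := pselect (forall s, ival L s -> h s = 0).
  have g0 y : ival L y -> (nu1 t <= y)%R -> g y <= 0.
    move=> yL _; rewrite /g /Rop integral0_eq ?mule0// => s sy.
    have sL := oo_ival_in (increasing_bijection_ival nu2L _ yL) _ sy.
    by rewrite h_eq0// abse0 mul0e.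
  have := iterated_le nu1L nu2L u1_gt0 u1_ni u2_gt0 v1_gt0 xi_gt0 v2_gt0 v2E h B t 0
    tL (ltW B_gt0) avg (lexx 0) g0.
  by rewrite mule0 adde0.
have ha0 : 0 < h a by rewrite lt0e h_ge0 andbT; apply/eqP.
have ntL := nu_ival _ tL.
pose b := Num.min a (nu t).
have bL : ival L b by rewrite /b; case: leP.
have hb0 : 0 < `|h b|.
  rewrite gee0_abs//; apply: (lt_le_trans ha0); apply: h_ni => //.
  by rewrite ge_min lexx.
have mu2 : lmeasurable_fun L (EFin \o u2) by exact: nonincreasing_lmeasurable.
have absh_ge0 s : ival L s -> 0 <= `|h s| by [].
have absh_ni : nonincreasing_on L (fun s => `|h s|).
  by move=> s s' sL s'L ss'; rewrite !gee0_abs//; exact: h_ni.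
have := weighted_integral_ge L _ u2 absh_ge0 absh_ni u2_gt0 mu2 b bL.
rewrite U2oo// gt0_muley// => Fb.
have bnt : (b <= nu t)%R by rewrite ge_min lexx orbT.
have Fnt := le_trans Fb (hardy_le u2_gt0 h _ _ bL ntL bnt).
have -> : phi t = +oo.
  rewrite /phi /Rop; move: Fnt; rewrite leye_eq => /eqP ->.
  by rewrite gt0_muley// lte_fin v_gt0.
by rewrite gt0_muley ?leey.
Qed.

Section finite.
Variables (c' C : R) (k : nat).
Hypotheses (c'_gt0 : (0 < c')%R) (C_gt0 : (0 < C)%R).
Hypothesis phi_le : forall s t, ival L s -> ival L t -> (t <= s)%R ->
  c'%:E * phi s <= rearrangement L phi (t / 2 ^+ k).
Hypothesis v2v_le : forall s t, ival L s -> ival L t -> (t <= s)%R ->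
  (v2 (nu1 s) / v s <= C * (v2 (nu1 t) / v t))%R.

(** [iterated_le] with the tail bound [M = (q / c')%:E * r]: the term with [phi t] contributes
    [B / c'] and the term with [M] contributes [B * C / c'], because the prefactor of [M] times
    [v2 (nu1 t) / v t] is just [B]. *)
Lemma iterated_le_dilation t : ival L t ->
  Rop u1 v1 nu1 (rearrangement L g) t <=
  ((B + B * C) / c')%:E * rearrangement L phi (t / 2 ^+ k).
Proof.
move=> tL; set r := rearrangement L phi _.
have r0 : 0 <= r by exact: rearrangement_ge0.
have xL := increasing_bijection_ival nu1L _ tL.
have phic s : ival L s -> (t <= s)%R -> phi s <= (c'^-1)%:E * r.
  by move=> sL ts; rewrite lee_pdivlMl//; exact: phi_le.
have vt0 := v_gt0 _ tL; have v2x0 := v2_gt0 _ xL.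
pose q := (C * (v2 (nu1 t) / v t))%R.
have q0 : (0 < q)%R by rewrite mulr_gt0// divr_gt0.
have M0 : 0 <= (q / c')%:E * r by rewrite mule_ge0// lee_fin ltW// divr_gt0.
have gM y : ival L y -> (nu1 t <= y)%R -> g y <= (q / c')%:E * r.
  move=> yL xy; have [[_ _ surj] incr] := nu1L.
  have [s sL ys] := surj _ yL.
  have ts : (t <= s)%R.
    by rewrite leNgt; apply/negP => st; move: xy; rewrite -ys leNgt incr.
  have vs0 := v_gt0 _ sL; have v2y0 := v2_gt0 _ yL.
  (* For [y = nu1 s], both [g y] and [phi s] contain the same integral, over (0, nu s). *)
  have -> : g y = (v2 y / v s)%:E * phi s.
    rewrite /g /phi /Rop /nu /= ys muleA -EFinM.
    by rewrite divfK// gt_eqF.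
  have -> : (q / c')%:E * r = q%:E * ((c'^-1)%:E * r) by rewrite EFinM muleA.
  apply: lee_pmul.
  - by rewrite lee_fin ltW// divr_gt0.
  - by apply: mule_ge0; [rewrite lee_fin ltW|exact: (hardy_ge0 u2_gt0 h _ (nu_ival _ sL))].
  - by rewrite lee_fin -ys; exact: v2v_le.
  - exact: phic.
have := iterated_le nu1L nu2L u1_gt0 u1_ni u2_gt0 v1_gt0 xi_gt0 v2_gt0 v2E h B t _
  tL (ltW B_gt0) avg M0 gM.
move=> /le_trans; apply; rewrite mulrDl EFinD ge0_muleDl; first last.
- by rewrite lee_fin ltW// divr_gt0// mulr_gt0.
- by rewrite lee_fin ltW// divr_gt0.
apply: leeD.
  rewrite EFinM -muleA; apply: lee_wpmul2l; first by rewrite lee_fin ltW.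
  exact: phic.
rewrite muleA -EFinM; apply: lee_wpmul2r => //; rewrite lee_fin.
have x0 := xL.1; have u1x := u1_gt0 _ xL; have v1t := v1_gt0 _ tL.
rewrite le_eqVlt; apply/orP; left; apply/eqP; rewrite /q /v.
by field; rewrite !gt_eqF.
Qed.

End finite.
End iterated_upper.

(** * Norm estimates from the pointwise bounds *)

Theorem theorem3p26 (R : realType) (L : \bar R) (nu1 nu2 : R -> R)
  (C1 C2 A a1 b1 a2 b2 : R) :
  0 < L ->
  increasing_bijection L nu1 -> increasing_bijection L nu2 ->
  Dsup0 nu2 -> (L = +oo -> Dsupoo nu2) ->
  (0 < C1)%R -> (0 < C2)%R ->
  (0 < a1)%R -> (0 < b1)%R -> (0 < a2)%R -> (0 < b2)%R ->
  exists c1 c2 : R, [/\ (0 < c1)%R, (0 < c2)%R &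
  forall (X : (R -> \bar R) -> \bar R) (u1 u2 v1 v2 xi : R -> R),
  ri_norm L X ->
  positive_on L u1 -> nonincreasing_on L (EFin \o u1) ->
  positive_on L u2 -> nonincreasing_on L (EFin \o u2) ->
  positive_on L v1 -> {within ival L, continuous v1} ->
  positive_on L xi -> lmeasurable_fun L (EFin \o xi) ->
  positive_on L v2 ->
  (forall t, ival L t -> ((v2 t)^-1)%:E = primitive xi (nu2 t)) ->
  averaging_constant L (fun t => u1 t * v2 t)%R = A%:E ->
  let nu := nu2 \o nu1 in
  let nu_inv := 'pinv_(fun=> 0%R) (ival L) nu in
  let v := fun t => (nu1 t * u1 (nu1 t) * v1 t * v2 (nu1 t))%R in
  let U2 := primitive u2 in
  let eta := fun t => (U2 t * (v (nu_inv t))%:E)^-1 in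
  equiv_nonincreasing L a1 b1 eta ->
  equiv_nonincreasing L a2 b2 (fun t => eta t / (xi t)%:E) ->
  (\forall t \ae leb, ival L t ->
     \int[leb]_(s in `]0%R, t[) (eta s * (u2 s)%:E) <= C1%:E * U2 t * eta t) ->
  (\forall t \ae leb, ival L t ->
     (t^-1)%:E * \int[leb]_(s in `]0%R, t[) (U2 (nu s) * (v s)%:E)
       >= C2%:E * U2 (nu t) * (v t)%:E) ->
  forall f : R -> \bar R, Mplus L f ->
    let P := X (Rop u1 v1 nu1
                  (rearrangement L (Rop u2 v2 nu2 (rearrangement L f)))) in
    let Q := X (Rop u2 v nu (rearrangement L f)) in
    c1%:E * Q <= P /\ P <= c2%:E * Q].
Proof.
move=> L0 nu1L nu2L D0 Doo C10 C20 a10 b10 a20 b20.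
have [theta [K [th1 K0 dbl]]] := doubling L0 nu2L D0 Doo.
pose B := (2 * Num.max A 1)%R.
have B0 : (0 < B)%R by rewrite mulr_gt0// lt_max ltr01 orbT.
pose C := (b1 * b2 / a1 * (2 * C1 * b1 / a1 / a2))%R.
have C0 : (0 < C)%R by rewrite !(mulr_gt0, invr_gt0).
pose c' := (C2 / 2 / (b1 / a1))%R.
have c'0 : (0 < c')%R by rewrite !(mulr_gt0, invr_gt0).
pose delta := (C2 / (2 * (b1 / a1)))%R.
have delta0 : (0 < delta)%R by rewrite !(mulr_gt0, invr_gt0).
(* This makes [t / 2 ^+ k < delta / 2 * t], with [k] depending on the constants only. *)
have [k kdelta] : exists k, (2 < delta * 2 ^+ k)%R.
  exists (Num.truncn (2 / delta)).+1; rewrite mulrC -ltr_pdivrMr//.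
  apply: (lt_le_trans (truncnS_gt _)).
  by rewrite -natrX ler_nat ltnW// ltn_expl.
pose c'' := ((B + B * C) / c')%R.
have c''0 : (0 < c'')%R by rewrite divr_gt0// addr_gt0// mulr_gt0.
(* The upper constant is a sum in order to serve both alternatives below: [B] for infinite [U2], and
   [c'' * 2 ^+ k] for finite [U2], where [2 ^+ k] bounds the norm of the dilation. *)
exists ((1 - theta^-1) / K)%R, (B + c'' * 2 ^+ k)%R; split.
- by rewrite divr_gt0// subr_gt0 invf_lt1//; lra.
- by rewrite addr_gt0// mulr_gt0// exprn_gt0.
move=> X u1 u2 v1 v2 xi riX u10 u1ni u20 u2ni v10 v1c xi0 mxi v20 v2E wA nu nu_inv
  v U2 eta etaeq etaxieq etaint U2vint f Mf P Q.
have nuL := increasing_bijection_comp nu1L nu2L.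
have x_ival t : ival L t -> ival L (nu1 t) by exact: increasing_bijection_ival nu1L t.
have v0 : positive_on L v.
  move=> t tL; have xL := x_ival _ tL.
  by rewrite /v !mulr_gt0 ?u10 ?v10 ?v20//; exact: xL.1.
have v2ni : nonincreasing_on L (EFin \o v2).
  by move=> s t sL tL st; rewrite lee_fin; exact: (v2_nonincreasing nu2L xi0 v20 v2E).
have comp_ni u : nonincreasing_on L (EFin \o u) ->
    lmeasurable_fun L (EFin \o (u \o nu1)).
  move=> uni; apply: nonincreasing_lmeasurable => s t sL tL st; apply: uni.
  - exact: x_ival.
  - exact: x_ival.
  - exact: increasing_bijection_le nu1L _ _ sL tL st.
have mnu1 : lmeasurable_fun L (EFin \o nu1).
  apply: nondecreasing_lmeasurable => s t sL tL st; rewrite lee_fin.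
  exact: increasing_bijection_le nu1L _ _ sL tL st.
have mv1 := continuous_lmeasurable v1c.
have mv : lmeasurable_fun L (EFin \o v).
  apply: lmeasurableM; last exact: comp_ni v2ni.
  by apply: lmeasurableM => //; apply: lmeasurableM => //; exact: comp_ni u1ni.
pose h := rearrangement L f; pose g := Rop u2 v2 nu2 h; pose phi := Rop u2 v nu h.
pose p := Rop u1 v1 nu1 (rearrangement L g).
have h0 t : 0 <= h t by exact: rearrangement_ge0.
have hni : nonincreasing_on L h.
  by move=> s t _ _; exact: rearrangement_nonincreasing.
have Mphi : Mplus L phi by exact: (Mplus_Rop _ nuL u20 v0 mv).
have Mp : Mplus L p by exact: (Mplus_Rop _ nu1L u10 v10 mv1).
have MZ c (q : R -> \bar R) : (0 <= c)%R -> Mplus L q -> Mplus L (fun t => c%:E * q t).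
  move=> c0 [mq q0]; split.
    by apply: emeasurable_funM; [exact: measurable_cst|exact: mq].
  move: q0; apply: (@filterS _ _ (ae_filter_ringOfSetsType (@completed_lebesgue_measure R))).
  by move=> t q0 tL; rewrite mule_ge0 ?lee_fin// q0.
have phiX0 : 0 <= X phi by exact: ri_ge0 riX _ Mphi.
rewrite -/h -/g -/phi -/p in P Q *; rewrite /P /Q; split.
  have c0 : (0 <= (1 - theta^-1) / K)%R.
    by rewrite ltW// divr_gt0// subr_gt0 invf_lt1//; lra.
  rewrite -(ri_scale riX Mphi c0); apply: (ri_monotone riX) => //; first exact: MZ.
  apply: aeW => t tL.
  exact: (iterated_ge nu1L nu2L u10 u1ni u20 u2ni v10 xi0 v20 v2E h h0 hni _ _ t th1 K0 dbl tL).
have wni : nonincreasing_on L (EFin \o (fun t => u1 t * v2 t)%R).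
  move=> s t sL tL st; rewrite lee_fin; apply: ler_pM.
  - by rewrite ltW// u10.
  - by rewrite ltW// v20.
  - exact: u1ni.
  - exact: v2ni.
have w0 : positive_on L (fun t => u1 t * v2 t)%R.
  by move=> t tL; rewrite mulr_gt0 ?u10 ?v20.
have avg x : ival L x -> primitive (fun t => u1 t * v2 t)%R x <=
    (B * (x * (u1 x * v2 x)))%:E.
  exact: averaging_bound w0 wni wA.
have [U2fin|/existsNP[t0 /not_implyP[t0L U2t0]]] :=
    pselect (forall t, ival L t -> U2 t < +oo); last first.
  have U2oo t : ival L t -> U2 t = +oo.
    move=> tL; apply/eqP; rewrite -leye_eq leNgt; apply/negP => U2t; apply: U2t0.
    exact: primitive_lty u20 u2ni tL t0L U2t.
  apply: (@le_trans _ _ (B%:E * X phi)); last first.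
    apply: lee_wpmul2r => //; rewrite lee_fin lerDl.
    by rewrite mulr_ge0 ?exprn_ge0// ltW.
  rewrite -(ri_scale riX Mphi (ltW B0)); apply: (ri_monotone riX) => //.
    by apply: MZ => //; exact: ltW.
  apply: aeW => t tL.
  exact: (iterated_le_infinite nu1L nu2L u10 u1ni u20 u2ni v10 xi0 v20 v2E h h0 hni B B0 avg t U2oo tL).
pose U t := fine (U2 t); pose e t := fine (eta t).
have UE t : ival L t -> primitive u2 t = (U t)%:E.
  move=> tL; rewrite fineK// ge0_fin_numE ?U2fin//.
  by apply: (primitive_ge0 _ _ u20); exact: ltW tL.2.
(* [nu_inv] is a partial inverse with default value 0; at [nu t] with [t] in (0, L) it returns
   [t]. *)
have etaE t : ival L t -> eta (nu t) = (primitive u2 (nu t) * (v t)%:E)^-1.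
  move=> tL; rewrite /eta /nu_inv pinvKV ?inE//.
  by have [[_ nu_inj _] _] := nuL.
have eE t : ival L t -> eta t = (e t)%:E.
  move=> tL; rewrite fineK//; have [[_ _ surj] _] := nuL.
  have [s sL <-] := surj _ tL.
  have nsL := increasing_bijection_ival nuL _ sL.
  have U0 : (0 < U (nu s))%R by rewrite -lte_fin -UE//; exact: primitive_gt0 u20 u2ni nsL.
  by rewrite etaE// (UE _ nsL) -EFinM inver gt_eqF// mulr_gt0// v0.
have phi_le s t := rearrangement_hardy_ge nu1L nu2L u10 u20 u2ni v10 v20 h h0 hni
  eta etaE U e UE eE a1 b1 C2 a10 b10 C20 etaeq U2vint mv k s t kdelta.
have v2v_le := v2_div_v_le nu1L nu2L u10 u20 u2ni v10 xi0 mxi v20 v2E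
  eta etaE U e UE eE a1 b1 a2 b2 C1 a10 b10 a20 b20 C10 etaeq etaxieq etaint.
pose r := rearrangement L phi.
have Mr : Mplus L (fun t => r (t / 2 ^+ k)%R).
  apply: Mplus_ge0 => [|t _]; last exact: rearrangement_ge0.
  apply: nonincreasing_lmeasurable => s t _ _ st; apply: rearrangement_nonincreasing.
  by rewrite ler_pM2r// invr_gt0 exprn_gt0.
apply: (@le_trans _ _ (c''%:E * X (fun t => r (t / 2 ^+ k)%R))).
  rewrite -(ri_scale riX Mr (ltW c''0)); apply: (ri_monotone riX) => //.
    by apply: MZ => //; exact: ltW.
  apply: aeW => t tL.
  exact: (iterated_le_dilation nu1L nu2L u10 u1ni u20 v10 xi0 v20 v2E h B B0 avg
    c' C k c'0 C0 phi_le v2v_le t tL).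
apply: (@le_trans _ _ (c''%:E * ((2 ^+ k)%:E * X phi))).
  apply: lee_wpmul2l; first by rewrite lee_fin ltW.
  exact: ri_dilation_le.
rewrite muleA -EFinM; apply: lee_wpmul2r => //.
by rewrite lee_fin lerDr ltW.
Qed.
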